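(* Let $\alpha\in\mathbb{R}^n\setminus\{0\}$ with number of effective frequencies $d$, let $\tau\ge d-1$, and assume $\alpha\in\mathcal{D}_d^\tau$. Let $Q_\alpha\ge1$ and $C_\alpha>0$ be constants such that $\Psi_\alpha(Q)\le C_\alpha Q^\tau$ for all $Q\ge Q_\alpha$ (such constants exist since $\alpha\in\mathcal{D}_d^\tau$). Let $s>0$, $\varepsilon>0$, and let $X=X_\alpha+P$ where $X_\alpha=\alpha$ is the constant vector field and $P$ is a bounded real-analytic vector field on $\mathbb{T}^n_s$ with $|P|_s\le\varepsilon$. Define $$E_\alpha=\max(1,d|\alpha|^{-1},Q_\alpha),\qquad \kappa_{d,\alpha}=2^6d^2(2^d-1)|\alpha|^{-1},$$ and assume that $$\varepsilon<(2C_\alpha)^{-1}(E_\alpha)^{-(\tau+1)},\qquad \varepsilon\le(2C_\alpha)^{-1}(\kappa_{d,\alpha}s^{-1})^{-(\tau+1)}.$$ Then there exists a real-analytic embedding $\Phi:\mathbb{T}^n_{s/2}\to\mathbb{T}^n_s$ such that $$\Phi^*X=X_\alpha+N+R,\qquad [X_\alpha,N]=0,$$ with the estimates $|\Phi-\mathrm{Id}|_{s/2}<d^2|\alpha|^{-1}(2C_\alpha\varepsilon)^{\frac1{1+\tau}}$ and $$|N|_{s/2}<2\varepsilon,\qquad |R|_{s/2}<2\varepsilon\exp\Bigl(-(\ln2)\,\kappa_{d,\alpha}^{-1}\,s\,(2C_\alpha\varepsilon)^{-\frac1{1+\tau}}\Bigr).$$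
   Context: Let $n\ge2$, $\mathbb{T}^n=\mathbb{R}^n/\mathbb{Z}^n$, $\mathbb{T}^n_{\mathbb{C}}=\mathbb{C}^n/\mathbb{Z}^n$. On $\mathbb{R}^n$ and $\mathbb{C}^n$, $|\cdot|$ is the maximum norm. For $s>0$, $\mathbb{T}^n_s=\{\theta\in\mathbb{T}^n_{\mathbb{C}} : |\mathrm{Im}\,\theta|<s\}$, and $|Y|_s=\sup_{z\in\mathbb{T}^n_s}|Y(z)|$ for a vector field (a $\mathbb{C}^n$-valued map) $Y$ on $\mathbb{T}^n_s$; $|\Phi-\mathrm{Id}|_r$ is the analogous supremum norm on $\mathbb{T}^n_r$. Real-analytic means analytic and real-valued at real arguments. $[\cdot,\cdot]$ is the Lie bracket of vector fields and $\Phi^*Y$ is the pull-back of $Y$ by $\Phi$. Write $\alpha=(\alpha_0,\dots,\alpha_{n-1})$, with coordinates labelled so that $|\alpha|=|\alpha_0|$ (standing convention). A subspace of $\mathbb{R}^n$ is rational if it has a basis of vectors in $\mathbb{Q}^n$; $F_\alpha$ is the smallest rational subspace of $\mathbb{R}^n$ containing $\alpha$, and $d=\dim F_\alpha$ is the number of effective frequencies of $\alpha$. For $Q\ge1$, $\Psi_\alpha(Q)$ is the infimum of the set of $K>0$ such that there exist $d$ linearly independent vectors $x=(x_0,\dots,x_{n-1})\in\mathbb{Z}^n\cap F_\alpha$ with $|x|\le K$ and $|x_0\alpha-\alpha_0x|\le Q^{-1}$. Let $C'_1$ be the least integer $Q\ge1$ for which there is a non-zero $x\in\mathbb{Z}^n\cap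 F_\alpha$ with $|x|\le Q$; for $Q\ge C'_1$ let $\Psi'_1(Q)$ be the supremum of the set of $K>0$ such that there is a non-zero $x\in\mathbb{Z}^n\cap F_\alpha$ with $|x|\le Q$ and $|x\cdot\alpha|\le K^{-1}$. For $\tau\ge d-1$, $\alpha\in\mathcal{D}_d^\tau$ means that there exist constants $Q'_\alpha\ge C'_1$ and $C'_\alpha>0$ such that $\Psi'_1(Q)\le C'_\alpha Q^\tau$ for all $Q\ge Q'_\alpha$; this is equivalent to the existence of $Q_\alpha\ge1$, $C_\alpha>0$ with $\Psi_\alpha(Q)\le C_\alpha Q^\tau$ for all $Q\ge Q_\alpha$. *)

(* Defs.v *)
From HB Require Import structures.
From mathcomp Require Import all_boot all_order all_algebra.
From mathcomp Require Import all_classical all_reals all_analysis.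
From mathcomp Require Import complex.

Set Implicit Arguments.
Unset Strict Implicit.
Unset Printing Implicit Defensive.

Import Order.TTheory GRing.Theory Num.Theory.
Import numFieldNormedType.Exports.

Local Open Scope classical_set_scope.
Local Open Scope ring_scope.

(* The library gives the norm topology to every abstract numClosedFieldType;
   the instances below make it available for the concrete type R[i]. *)
Section ComplexNormedType.
Variable R : realType.
#[non_forgetful_inheritance]
HB.instance Definition _ := GRing.ComAlgebra.copy R[i] R[i]^o.
#[non_forgetful_inheritance]
HB.instance Definition _ := Vector.copy R[i] R[i]^o.
#[non_forgetful_inheritance]
HB.instance Definition _ := NormedModule.copy R[i] R[i]^o.
End ComplexNormedType.

(* Vectors are row vectors; the norm of 'rV[R]_n and of 'rV[R[i]]_n provided
   by the library is the maximum norm. *)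

Section Arithmetic.
Context {R : realType} {n : nat}.
Implicit Types (alpha : 'rV[R]_n) (V F : {vspace 'rV[R]_n}) (Q : R).

Definition zvec (x : 'rV[int]_n) : 'rV[R]_n := map_mx intr x.

Definition qvec (x : 'rV[rat]_n) : 'rV[R]_n := map_mx ratr x.

Definition dotp (u v : 'rV[R]_n) : R := \sum_j u 0 j * v 0 j.

Definition rational_space V : Prop :=
  exists b : seq 'rV[rat]_n, basis_of V (map qvec b).

Definition smallest_rational_space alpha V : Prop :=
  [/\ rational_space V, alpha \in V &
      forall W, rational_space W -> alpha \in W -> (V <= W)%VS].

(* The default value of xget is never used: see rational_hullP below. *)
Definition rational_hull alpha : {vspace 'rV[R]_n} :=
  xget fullv [set V | smallest_rational_space alpha V].

Definition num_eff_freq alpha : nat := \dim (rational_hull alpha).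

(* i0 is the index of the distinguished coordinate alpha_0.  The infimum is
   taken in the extended reals, so that the infimum of an empty set is +oo. *)
Definition Psi (i0 : 'I_n) alpha Q : \bar R :=
  ereal_inf [set K%:E | K in [set K : R | 0 < K /\
    exists x : (num_eff_freq alpha).-tuple 'rV[int]_n,
      free (map zvec x) /\
      forall v, v \in x ->
        [/\ zvec v \in rational_hull alpha,
            `|zvec v| <= K &
            `|zvec v 0 i0 *: alpha - alpha 0 i0 *: zvec v| <= Q^-1]]].

Definition short_vector alpha Q (x : 'rV[int]_n) : Prop :=
  [/\ x != 0, zvec x \in rational_hull alpha & `|zvec x| <= Q].

Definition has_short_vector alpha (q : nat) : Prop :=
  (1 <= q)%N /\ exists x, short_vector alpha q%:R x.

(* For alpha != 0 the default value of xget is never used: see C1'P below. *)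
Definition C1' alpha : nat :=
  xget 0%N [set q | has_short_vector alpha q /\
    forall p, has_short_vector alpha p -> (q <= p)%N].

Definition Psi1' alpha Q : \bar R :=
  ereal_sup [set K%:E | K in [set K : R | 0 < K /\
    exists x, short_vector alpha Q x /\ `|dotp (zvec x) alpha| <= K^-1]].

Definition Diophantine alpha (tau : R) : Prop :=
  exists Q' C' : R, [/\ (C1' alpha)%:R <= Q', 0 < C' &
    forall Q, Q' <= Q -> (Psi1' alpha Q <= (C' * Q `^ tau)%:E)%E].

Definition E_alpha alpha (Qa : R) : R :=
  Num.max 1 (Num.max ((num_eff_freq alpha)%:R * `|alpha|^-1) Qa).

Definition kappa alpha : R :=
  let d := num_eff_freq alpha in
  2 ^+ 6 * d%:R ^+ 2 * (2 ^+ d - 1) * `|alpha|^-1.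

End Arithmetic.

Section ComplexTorus.
Context {R : realType} {n : nat}.
Implicit Types (r s : R) (z w : 'rV[R[i]]_n) (Y : 'rV[R[i]]_n -> 'rV[R[i]]_n).

Definition cvec (x : 'rV[R]_n) : 'rV[R[i]]_n := map_mx (real_complex R) x.

Definition czvec (k : 'rV[int]_n) : 'rV[R[i]]_n := cvec (zvec k).

Definition imvec z : 'rV[R]_n := map_mx (@complex.Im R) z.

(* The library's norm on 'rV[R[i]]_n takes its values in R[i]. *)
Definition cnorm z : R := complex.Re `|z|.

(* The preimage in C^n of the complex torus of width s. *)
Definition strip s : set 'rV[R[i]]_n := [set z | `|imvec z| < s].

(* Equal to +oo when Y is unbounded on the strip. *)
Definition supnorm s Y : \bar R :=
  ereal_sup [set (cnorm (Y z))%:E | z in strip s].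

(* A map is analytic on the open set [strip s] when it is complex
   differentiable there: the base field of [differentiable] is R[i]. *)
Definition real_analytic s Y : Prop :=
  (forall z, strip s z -> differentiable Y z) /\
  (forall x : 'rV[R]_n, imvec (Y (cvec x)) = 0).

(* Vector fields on the torus are Z^n-periodic maps; values outside of the
   strip are irrelevant. *)
Definition real_analytic_vector_field s Y : Prop :=
  real_analytic s Y /\
  (forall z k, strip s z -> Y (z + czvec k) = Y z).

Definition constant_field (alpha : 'rV[R]_n) : 'rV[R[i]]_n -> 'rV[R[i]]_n :=
  fun=> cvec alpha.

(* Y z and 'd Y z are row vectors and a C-linear map on row vectors. *)
Definition lie_bracket (X Y : 'rV[R[i]]_n -> 'rV[R[i]]_n) :
    'rV[R[i]]_n -> 'rV[R[i]]_n :=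
  fun z => 'd Y z (X z) - 'd X z (Y z).

(* (D Phi (z))^-1 applied to X (Phi z); with row vectors, 'J Phi z is the
   transpose of the usual Jacobian matrix and acts on the right. *)
Definition pullback (Phi X : 'rV[R[i]]_n -> 'rV[R[i]]_n) :
    'rV[R[i]]_n -> 'rV[R[i]]_n :=
  fun z => X (Phi z) *m invmx ('J Phi z).

(* Proximity in the quotient C^n / Z^n. *)
Definition torus_close (e : R) z w : Prop :=
  exists k : 'rV[int]_n, cnorm (z - w - czvec k) < e.

Definition torus_eq z w : Prop := exists k : 'rV[int]_n, z = w + czvec k.

(* Phi is a lift to C^n of a map of tori homotopic to the inclusion, i.e.
   Phi - Id is Z^n-periodic; this is what gives a meaning to Phi - Id as a
   C^n-valued map on the torus.  The last three clauses say that the map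
   induced on the tori is injective, an immersion, and has a continuous
   inverse on its image. *)
Record real_analytic_embedding r s (Phi : 'rV[R[i]]_n -> 'rV[R[i]]_n) : Prop :=
  RealAnalyticEmbedding {
    embedding_equivariant : forall z k, strip r z ->
      Phi (z + czvec k) = Phi z + czvec k;
    embedding_range : forall z, strip r z -> strip s (Phi z);
    embedding_analytic : real_analytic r Phi;
    embedding_injective : forall z w, strip r z -> strip r w ->
      torus_eq (Phi z) (Phi w) -> torus_eq z w;
    embedding_immersion : forall z, strip r z -> 'J Phi z \in unitmx;
    embedding_inverse_continuous : forall z, strip r z ->
      forall e : R, 0 < e -> exists2 delta : R, 0 < delta &
        forall w, strip r w ->
          torus_close delta (Phi w) (Phi z) -> torus_close e w z
  }.

End ComplexTorus.

Section RationalHull.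
Context {R : realType} {n : nat}.

Let rowseq (K : fieldType) m (A : 'M[K]_(m, n)) : m.-tuple 'rV[K]_n :=
  [tuple row i A | i < m].

Let mem_rowspan (K : fieldType) m (A : 'M[K]_(m, n)) (v : 'rV[K]_n) :
  (v \in <<rowseq A>>%VS) = (v <= A)%MS.
Proof.
apply/idP/idP => [/coord_span ->|/submxP[D ->]].
  apply: summx_sub => i _; apply: scalemx_sub.
  by rewrite (_ : _`_i = row i A) ?row_sub// -tnth_nth tnth_mktuple.
rewrite mulmx_sum_row; apply: memv_suml => i _; apply: memvZ.
by apply: memv_span; apply/tnthP; exists i; rewrite tnth_mktuple.
Qed.

Let free_rows (K : fieldType) m (A : 'M[K]_(m, n)) :
  row_free A -> free (rowseq A).
Proof.
move=> fA; apply/freeP => c c0 i.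
have e : (\row_j c j) *m A = 0.
  rewrite mulmx_sum_row -[RHS]c0; apply: eq_bigr => j _.
  by rewrite mxE -tnth_nth tnth_mktuple.
have /rowP/(_ i) : \row_j c j = 0.
  by apply: (row_free_inj fA); rewrite e mul0mx.
by rewrite !mxE.
Qed.

Let qspan m (A : 'M[rat]_(m, n)) : {vspace 'rV[R]_n} :=
  <<rowseq (map_mx ratr A)>>%VS.

Let qspan_rational m (A : 'M[rat]_(m, n)) : rational_space (qspan A).
Proof.
exists (rowseq (row_base A)); rewrite /basis_of.
have -> : map (@qvec R n) (rowseq (row_base A)) =
    rowseq (map_mx ratr (row_base A)).
  by rewrite -map_comp; apply: eq_map => i; rewrite /= /qvec map_row.
apply/andP; split; last by apply: free_rows; rewrite row_free_map row_base_free.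
apply/eqP/vspaceP => v; rewrite !mem_rowspan.
by apply/idP/idP => /submx_trans; apply; rewrite map_submx eq_row_base.
Qed.

Let rational_qspan V : rational_space V ->
  exists m (A : 'M[rat]_(m, n)), V = qspan A.
Proof.
move=> [b /andP[/eqP <- _]]; exists (size b), (\matrix_(i < size b) b`_i).
congr (<<_>>%VS); apply: (@eq_from_nth _ 0).
  by rewrite size_map (size_tuple (rowseq _)).
rewrite size_map; move=> i ib; rewrite (nth_map 0)//.
have := tnth_nth 0 (rowseq (map_mx (@ratr R) (\matrix_(j < size b) b`_j)))
  (Ordinal ib).
by rewrite tnth_mktuple -map_row rowK => <-.
Qed.

Let rational_cap (V W : {vspace 'rV[R]_n}) :
  rational_space V -> rational_space W -> rational_space (V :&: W)%VS.
Proof.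
move=> /rational_qspan[m1 [A ->]] /rational_qspan[m2 [B ->]].
suff -> : (qspan A :&: qspan B)%VS = qspan (A :&: B)%MS by [].
apply/vspaceP => v.
by rewrite memv_cap !mem_rowspan map_capmx sub_capmx.
Qed.

Let rational_full : rational_space (fullv : {vspace 'rV[R]_n}).
Proof.
suff -> : fullv = qspan (1%:M : 'M[rat]_n) by [].
by apply/vspaceP => v; rewrite mem_rowspan memvf map_mx1 submx1.
Qed.

Lemma rational_hullP (alpha : 'rV[R]_n) :
  smallest_rational_space alpha (rational_hull alpha).
Proof.
apply: (@xgetPex _ _ [set V | smallest_rational_space alpha V]).
pose P d := `[< exists V : {vspace 'rV[R]_n},
  [/\ rational_space V, alpha \in V & \dim V = d] >].
have exP : exists d, P d.
  exists (\dim (fullv : {vspace 'rV[R]_n})); apply/asboolP.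
  by exists fullv; split => //; rewrite memvf.
case: (ex_minnP exP) => d /asboolP[V [rV aV dV]] dmin.
exists V; split => // W rW aW.
have /dmin dd : P (\dim (V :&: W)%VS).
  apply/asboolP; exists (V :&: W)%VS; split => //; first exact: rational_cap.
  by rewrite memv_cap aV.
apply/capv_idPl/eqP; rewrite eqEdim capvSl /=; rewrite dV; exact: dd.
Qed.

Lemma C1'P (alpha : 'rV[R]_n) : alpha != 0 ->
  has_short_vector alpha (C1' alpha) /\
  forall p, has_short_vector alpha p -> (C1' alpha <= p)%N.
Proof.
move=> alpha0; apply: (@xgetPex _ _ [set q | has_short_vector alpha q /\
  forall p, has_short_vector alpha p -> (q <= p)%N]).
suff exP : exists q, `[< has_short_vector alpha q >].
  case: (ex_minnP exP) => q /asboolP qP qmin; exists q; split => // p pP.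
  by apply: qmin; apply/asboolP.
have [[[|q b] /andP[/eqP hb fb]] aV _] := rational_hullP alpha.
  by move: aV alpha0; rewrite -hb span_nil memv0 => ->.
have qV : qvec q \in rational_hull alpha.
  by rewrite -hb memv_span// mem_head.
have q0 : qvec q != 0 :> 'rV[R]_n.
  move: fb; rewrite /= free_cons => /andP[+ _].
  by apply: contraNneq => ->; rewrite mem0v.
pose D : int := \prod_j denq (q 0 j).
have D0 : D != 0 by apply/prodf_neq0 => j _; rewrite denq_neq0.
pose x : 'rV[int]_n :=
  \row_j (numq (q 0 j) * \prod_(k | k != j) denq (q 0 k)).
have xE : zvec x = D%:~R *: qvec q :> 'rV[R]_n.
  apply/rowP => j; rewrite !mxE /D [in RHS](bigD1 j)//= !intrM /ratr.
  by rewrite [RHS]mulrC -mulrA mulKf// intr_eq0 denq_neq0.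
have zx0 : zvec x != 0 :> 'rV[R]_n by rewrite xE scaler_eq0 intr_eq0 negb_or D0.
exists (Num.bound `|zvec x : 'rV[R]_n|).+1; apply/asboolP; split => //.
exists x; split.
- by apply: contra_neq zx0 => ->; apply/rowP => j; rewrite !mxE.
- by rewrite xE memvZ.
- rewrite (le_trans (ltW (archi_boundP (normr_ge0 _))))//.
  by rewrite ler_nat.
Qed.

End RationalHull.

(* Main.v *)
From HB Require Import structures.
Require Import Defs.
From mathcomp Require Import all_boot all_order all_algebra.
From mathcomp Require Import all_classical all_reals all_analysis.
From mathcomp Require Import complex.
From mathcomp Require Import ring lra.

(** The vectors [x] counted by [Psi] give periodic approximations [t^-1 *: x] of
    [alpha], with [t = x_0 / alpha_0]: they span a space that contains [alpha],
    and [|t|] times their distance to [alpha] is at most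
    [b = |alpha|^-1 * Q^-1].  The choice [Q = (2 * Ca * eps) ^ (- 1 / (1 + tau))]
    also makes [|t| * eps <= b / 2].

    One averaging ([averaging_step]) removes from a perturbation [S] everything
    but its mean [A] along the closed orbits of [x].  The change of variables is
    [z + U z], where [U = t *: G] and the first moment
    [G z = int_0^1 u * S (z + u * x) du] solves the homological equation
    [DG . x = S - A] ([averaging]).  By Cauchy's estimates on a strip that is
    narrower by [delta], what is left over is a bounded multiple of
    [(b / delta) * |S|].  Averaging along [d] independent vectors one after the
    other keeps the invariances already obtained; so the mean that remains is
    invariant along all these vectors, hence along [alpha], and is added to the
    normal form [N].  With [32 * d * b <= delta] the remainder of such a round is
    at most half of the perturbation it started from ([averaging_steps]).
    Therefore [m] rounds leave a remainder of size [2 ^- m * eps], while the sizes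
    of the normal form and of the displacement are geometric sums
    ([averaging_iteration]).  A loss [s / 2] of width allows
    [m = floor (s * Q / kappa)] rounds, which is the exponential estimate.

    The analytic tools are derived from complex differentiability alone.
    Goursat's bisection argument, applied to contour sums over dyadic grids
    ([goursat]) in a logarithmic coordinate, shows that means over circles do
    not depend on the radius; this gives Cauchy's estimate
    ([schwarz_estimate], [cauchy_estimate1], [cauchy_ball]).  Cauchy's estimate
    yields that uniform limits ([holo_limit]) and derivatives ([holo_jacobian])
    of holomorphic maps are holomorphic, which covers the means, the moments and
    the pulled back vector fields ([field_solve]).

    Each change of variables satisfies a lower Lipschitz bound; the bound is
    preserved under composition and makes the composition an embedding. *)

Import Order.TTheory GRing.Theory Num.Theory.
Import numFieldNormedType.Exports.

Set Implicit Arguments.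
Unset Strict Implicit.
Unset Printing Implicit Defensive.

Local Open Scope classical_set_scope.
Local Open Scope complex_scope.
Local Open Scope ring_scope.

(** * Norms on complex numbers and complex vectors *)

Section Norms.
Context {R : realType}.
Implicit Types (c e : R[i]) (a b : R).

(** [`|c|] itself is an element of [R[i]], with imaginary part zero. *)
Definition cabs c : R := complex.Re `|c|.

Lemma cabsE c : `|c| = (cabs c)%:C.
Proof. by rewrite /cabs RRe_real ?normr_real. Qed.

Lemma cabs_ge0 c : 0 <= cabs c.
Proof. by rewrite -ler0c -cabsE. Qed.

Lemma cabs_le c a : (cabs c <= a) = (`|c| <= a%:C).
Proof. by rewrite cabsE lecR. Qed.

Lemma cabsD c e : cabs (c + e) <= cabs c + cabs e.
Proof. by rewrite cabs_le rmorphD /= -!cabsE ler_normD. Qed.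

Lemma cabsM c e : cabs (c * e) = cabs c * cabs e.
Proof. by apply: (@complexI R); rewrite rmorphM /= -!cabsE normrM. Qed.

Lemma cabsN c : cabs (- c) = cabs c.
Proof. by rewrite /cabs normrN. Qed.

Lemma cabs0 : cabs 0 = 0.
Proof. by rewrite /cabs normr0. Qed.

Lemma cabs1 : cabs 1 = 1.
Proof. by rewrite /cabs normr1. Qed.

Lemma cabs_def c :
  cabs c = Num.sqrt (complex.Re c ^+ 2 + complex.Im c ^+ 2).
Proof. by rewrite /cabs normc_def. Qed.

Lemma cabs_real a : cabs a%:C = `|a|.
Proof. by rewrite cabs_def /= expr0n addr0 sqrtr_sqr. Qed.

Lemma cabs_i : cabs 'i = 1.
Proof. by rewrite cabs_def /= expr0n add0r expr1n sqrtr1. Qed.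

Lemma cabs_Re c : `|complex.Re c| <= cabs c.
Proof. by rewrite cabs_def -sqrtr_sqr ler_wsqrtr // lerDl sqr_ge0. Qed.

Lemma cabs_Im c : `|complex.Im c| <= cabs c.
Proof. by rewrite cabs_def -sqrtr_sqr ler_wsqrtr // lerDr sqr_ge0. Qed.

Lemma cabs_le_ReIm c : cabs c <= `|complex.Re c| + `|complex.Im c|.
Proof.
rewrite {1}[c]complexE (le_trans (cabsD _ _)) // cabsM cabs_i mul1r.
by rewrite !cabs_real.
Qed.

Section Vectors.
Context {n : nat}.
Implicit Types z w : 'rV[R[i]]_n.

Lemma cnormE z : `|z| = (cnorm z)%:C.
Proof. by rewrite /cnorm RRe_real ?normr_real. Qed.

Lemma cnorm_ge0 z : 0 <= cnorm z.
Proof. by rewrite -ler0c -cnormE normr_ge0. Qed.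

Lemma cnorm_le z a : (cnorm z <= a) = (`|z| <= a%:C).
Proof. by rewrite cnormE lecR. Qed.

Lemma cnormD z w : cnorm (z + w) <= cnorm z + cnorm w.
Proof. by rewrite cnorm_le rmorphD /= -!cnormE ler_normD. Qed.

Lemma cnormN z : cnorm (- z) = cnorm z.
Proof. by rewrite /cnorm normrN. Qed.

Lemma cnormB z w : cnorm (z - w) <= cnorm z + cnorm w.
Proof. by rewrite -(cnormN w) cnormD. Qed.

Lemma cnormC z w : cnorm (z - w) = cnorm (w - z).
Proof. by rewrite -cnormN opprB. Qed.

Lemma cnormZ c z : cnorm (c *: z) = cabs c * cnorm z.
Proof.
by apply: (@complexI R); rewrite rmorphM /= -cabsE -!cnormE normrZ.
Qed.

Lemma cnorm0 : cnorm (0 : 'rV[R[i]]_n) = 0.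
Proof. by rewrite /cnorm normr0. Qed.

Lemma cnorm_eq0 z : (cnorm z == 0) = (z == 0).
Proof. by rewrite -(inj_eq (@complexI R)) /= -cnormE normr_eq0. Qed.

Lemma cnorm_tri w z y : cnorm (z - y) <= cnorm (z - w) + cnorm (w - y).
Proof. by rewrite (le_trans _ (cnormD _ _)) // addrA subrK. Qed.

Lemma mx_norm_leP (K : numDomainType) m p (A : 'M[K]_(m, p)) (a' : K) :
  0 <= a' -> reflect (forall i j, `|A i j| <= a') (mx_norm A <= a').
Proof.
move=> /nonnegP[{}a']; rewrite mx_normE num_le.
apply: (iffP (bigmax_leP _ _ _ (fun=> _%:itv))) => /= [[_ Aa] i j|Aa].
  exact: (Aa (i, j)).
by split => [|[i j] _]; rewrite -num_le //=.
Qed.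

Lemma cnormP z a :
  reflect (0 <= a /\ forall j, cabs (z 0 j) <= a) (cnorm z <= a).
Proof.
apply: (iffP idP) => [za|[a0 za]].
  have a0 : 0 <= a := le_trans (cnorm_ge0 _) za.
  split=> // j; rewrite cabs_le; move: za; rewrite cnorm_le.
  by move/mx_norm_leP; rewrite ler0c; apply.
rewrite cnorm_le; apply/mx_norm_leP; rewrite ?ler0c// => i j.
by rewrite (ord1 i) -cabs_le.
Qed.

Lemma cnorm_entry z j : cabs (z 0 j) <= cnorm z.
Proof. by have /cnormP[] := lexx (cnorm z). Qed.

Lemma rnormP (x : 'rV[R]_n) a :
  reflect (0 <= a /\ forall j, `|x 0 j| <= a) (`|x| <= a).
Proof.
apply: (iffP idP) => [xa|[a0 xa]].
  have a0 : 0 <= a := le_trans (normr_ge0 _) xa.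
  by split=> // j; move: xa => /(mx_norm_leP _ a0); apply.
by apply/mx_norm_leP => // i j; rewrite (ord1 i).
Qed.

Lemma rnorm_entry (x : 'rV[R]_n) j : `|x 0 j| <= `|x|.
Proof. by have /rnormP[] := lexx `|x|. Qed.

Lemma cnorm_cvec (x : 'rV[R]_n) : cnorm (cvec x) = `|x|.
Proof.
apply/le_anti/andP; split.
  by apply/cnormP; split=> // j; rewrite mxE cabs_real rnorm_entry.
apply/rnormP; split=> [|j]; first exact: cnorm_ge0.
by rewrite -cabs_real (le_trans _ (cnorm_entry _ j)) // mxE.
Qed.

Lemma cnorm_imvec z : `|imvec z| <= cnorm z.
Proof.
apply/rnormP; split=> [|j]; first exact: cnorm_ge0.
by rewrite mxE (le_trans (cabs_Im _)) ?cnorm_entry.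
Qed.

Lemma cnormD_le z w a b : cnorm z <= a -> cnorm w <= b -> cnorm (z + w) <= a + b.
Proof. by move=> za wb; rewrite (le_trans (cnormD _ _))// lerD. Qed.

Lemma cnormB_le z w a b : cnorm z <= a -> cnorm w <= b -> cnorm (z - w) <= a + b.
Proof. by rewrite -(cnormN w); exact: cnormD_le. Qed.

Lemma imvecD z w : imvec (z + w) = imvec z + imvec w.
Proof. by apply/rowP => j; rewrite !mxE; case: (z 0 j); case: (w 0 j). Qed.

Lemma imvecN z : imvec (- z) = - imvec z.
Proof. by apply/rowP => j; rewrite !mxE; case: (z 0 j). Qed.

Lemma imvecB z w : imvec (z - w) = imvec z - imvec w.
Proof. by rewrite imvecD imvecN. Qed.

Lemma imvec0 : imvec (0 : 'rV[R[i]]_n) = 0.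
Proof. by apply/rowP => j; rewrite !mxE. Qed.

Lemma imvecZ a z : imvec (a%:C *: z) = a *: imvec z.
Proof.
by apply/rowP => j; rewrite !mxE; case: (z 0 j) => x y /=; rewrite mul0r addr0.
Qed.

Lemma imvec_cvec (x : 'rV[R]_n) : imvec (cvec x) = 0.
Proof. by apply/rowP => j; rewrite !mxE. Qed.

Lemma cvecD (x y : 'rV[R]_n) : cvec (x + y) = cvec x + cvec y.
Proof. by apply/rowP => j; rewrite !mxE rmorphD. Qed.

Lemma cvecZ a (x : 'rV[R]_n) : cvec (a *: x) = a%:C *: cvec x.
Proof. by apply/rowP => j; rewrite !mxE rmorphM. Qed.

Lemma imvec_eq0 z : imvec z = 0 -> z = cvec (map_mx (@complex.Re R) z).
Proof.
move=> z0; apply/rowP => j; have /rowP/(_ j) := z0; rewrite !mxE.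
by case: (z 0 j) => x y /= ->.
Qed.

End Vectors.

End Norms.

Section RowCoordinates.
Context {R : realType} {m : nat}.
Implicit Types (u v : 'rV[R[i]]_m) (j : 'I_m) (a b c : R[i]).

Lemma coord_addE u v j a b : u 0 j = a -> v 0 j = b -> (u + v) 0 j = a + b.
Proof. by move=> <- <-; rewrite mxE. Qed.

Lemma coord_oppE u j a : u 0 j = a -> (- u) 0 j = - a.
Proof. by move=> <-; rewrite mxE. Qed.

Lemma coord_scaleE c u j a : u 0 j = a -> (c *: u) 0 j = c * a.
Proof. by move=> <-; rewrite mxE. Qed.

Lemma coord_zeroE j : (0 : 'rV[R[i]]_m) 0 j = 0.
Proof. by rewrite mxE. Qed.

Lemma eq_coords u v (f g : 'I_m -> R[i]) :
  (forall j, u 0 j = f j) -> (forall j, v 0 j = g j) -> f =1 g -> u = v.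
Proof. by move=> uf vg fg; apply/rowP => j; rewrite uf vg fg. Qed.

End RowCoordinates.

(** An equation between linear combinations of row vectors becomes an equation
    between scalars, by reading the coordinates off the syntax tree. *)
Ltac read_coord :=
  lazymatch goal with
  | |- @fun_of_matrix _ _ _ (@Algebra.add _ _ _) _ _ = _ =>
      eapply coord_addE; [read_coord | read_coord]
  | |- @fun_of_matrix _ _ _ (@Algebra.opp _ _) _ _ = _ =>
      eapply coord_oppE; read_coord
  | |- @fun_of_matrix _ _ _ (@GRing.scale _ _ _ _) _ _ = _ =>
      eapply coord_scaleE; read_coord
  | |- @fun_of_matrix _ _ _ (@Algebra.zero _) _ _ = _ => eapply coord_zeroE
  | |- _ => reflexivity
  end.

Ltac coordinates :=
  eapply eq_coords; [intro; read_coord | intro; read_coord | intro; cbv beta].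

Opaque cnorm cabs.

(** * Bisection and dyadic means *)

Section Bisection.
Context {R : realType}.

Lemma half_gt0 (h : R) : 0 < h -> 0 < h / 2.
Proof. by move=> h0; rewrite divr_gt0. Qed.

(** Otherwise repeated quartering produces squares on which [P] fails and that
    shrink to a point, where [P] holds for all small squares. *)
Lemma square_bisection (P : R -> R -> R -> Prop) :
  (forall (x y h : R), 0 < h -> P x y (h / 2) -> P (x + h / 2) y (h / 2) ->
    P x (y + h / 2) (h / 2) -> P (x + h / 2) (y + h / 2) (h / 2) ->
    P x y h) ->
  (forall (s t : R), 0 <= s <= 1 -> 0 <= t <= 1 -> exists2 delta : R, 0 < delta &
    forall (x y h : R), 0 < h < delta -> 0 <= x -> x + h <= 1 -> 0 <= y ->
      y + h <= 1 -> x <= s <= x + h -> y <= t <= y + h -> P x y h) ->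
  P 0 0 1.
Proof.
move=> Psplit Ploc; apply: contrapT => nP.
have step (q : R * R * R) : exists q' : R * R * R, 0 < q.2 ->
    ~ P q.1.1 q.1.2 q.2 -> [/\ ~ P q'.1.1 q'.1.2 q'.2, q'.2 = q.2 / 2,
      q.1.1 <= q'.1.1 <= q.1.1 + q.2 / 2 &
      q.1.2 <= q'.1.2 <= q.1.2 + q.2 / 2].
  case: q => [[x y] h] /=; have [h0|h0] := ltP 0 h; last first.
    by exists (0, 0, 0).
  have [Pq|nPq] := pselect (P x y h); first by exists (0, 0, 0).
  have h2 : 0 <= h / 2 by rewrite divr_ge0 // ltW.
  have [Q1|?] := pselect (P x y (h / 2)); last first.
    by exists (x, y, h / 2); split=> //=; lra.
  have [Q2|?] := pselect (P (x + h / 2) y (h / 2)); last first.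
    by exists (x + h / 2, y, h / 2); split=> //=; lra.
  have [Q3|?] := pselect (P x (y + h / 2) (h / 2)); last first.
    by exists (x, y + h / 2, h / 2); split=> //=; lra.
  have [Q4|?] := pselect (P (x + h / 2) (y + h / 2) (h / 2)); last first.
    by exists (x + h / 2, y + h / 2, h / 2); split=> //=; lra.
  by exfalso; apply: nPq; exact: Psplit.
have [f fP] := choice step.
pose q k := iter k f (0, 0, 1).
have qP k : ~ P (q k).1.1 (q k).1.2 (q k).2 /\ (q k).2 = 2 ^- k.
  elim: k => [|k [nPk hk]]; first by rewrite /= expr0 invr1.
  have h0 : 0 < (q k).2 by rewrite hk invr_gt0 exprn_gt0.
  have [nPk' hk' _ _] := fP (q k) h0 nPk.
  by split=> //; rewrite /= hk' hk exprS invfM mulrC.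
have qS k : [/\ (q k).1.1 <= (q k.+1).1.1 <= (q k).1.1 + (q k).2 / 2,
    (q k).1.2 <= (q k.+1).1.2 <= (q k).1.2 + (q k).2 / 2,
    (q k.+1).2 = (q k).2 / 2 & 0 < (q k).2].
  have [nPk hk] := qP k.
  have h0 : 0 < (q k).2 by rewrite hk invr_gt0 exprn_gt0.
  by have [nPk' hk' ? ?] := fP (q k) h0 nPk.
have nested (p : R * R * R -> R) :
    (forall k, p (q k) <= p (q k.+1) <= p (q k) + (q k).2 / 2) ->
    p (q 0) = 0 ->
    exists l : R, forall k, [/\ p (q k) <= l <= p (q k) + (q k).2,
      0 <= p (q k) & p (q k) + (q k).2 <= 1].
  move=> pq p0.
  have mono i k : p (q i) <= p (q (i + k)%N) /\
      p (q (i + k)%N) + (q (i + k)%N).2 <= p (q i) + (q i).2.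
    elim: k => [|k [h1 h2]]; first by rewrite addn0.
    rewrite addnS; have /andP[h3 h4] := pq (i + k)%N.
    by have [_ _ h5 _] := qS (i + k)%N; rewrite h5; split; lra.
  have ub k : ubound (range (fun i => p (q i))) (p (q k) + (q k).2).
    move=> _ [i _ <-]; have [ik|/ltnW ki] := leqP i k.
      have [+ _] := mono i (k - i)%N; rewrite subnKC // => h1.
      by have [_ _ _ h2] := qS k; lra.
    have [_] := mono k (i - k)%N; rewrite subnKC // => h1.
    by have [_ _ _ h2] := qS i; lra.
  exists (sup (range (fun i => p (q i)))) => k; split.
  - apply/andP; split.
      by apply: ub_le_sup; [exists (p (q k) + (q k).2); exact: ub|exists k].
    by apply: ge_sup; [exists (p (q k)), k|exact: ub].
  - by have [+ _] := mono 0 k; rewrite p0.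
  - by have [_] := mono 0 k; rewrite p0 add0r.
have [s sP] : exists l : R, forall k, [/\ (q k).1.1 <= l <= (q k).1.1 + (q k).2,
    0 <= (q k).1.1 & (q k).1.1 + (q k).2 <= 1].
  by apply: (nested (fun q => q.1.1)) => // k; have [] := qS k.
have [t tP] : exists l : R, forall k, [/\ (q k).1.2 <= l <= (q k).1.2 + (q k).2,
    0 <= (q k).1.2 & (q k).1.2 + (q k).2 <= 1].
  by apply: (nested (fun q => q.1.2)) => // k; have [] := qS k.
have [] := Ploc s t.
- by have [/=] := sP 0%N; rewrite add0r.
- by have [/=] := tP 0%N; rewrite add0r.
move=> delta d0 dP.
have [k kd] : exists k, 2 ^- k < delta.
  exists (Num.bound delta^-1); rewrite invf_plt ?posrE ?exprn_gt0 //.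
  rewrite (lt_trans (archi_boundP _)) ?invr_ge0 1?ltW //.
  by rewrite -natrX ltr_nat ltn_expl.
have [nPk hk] := qP k; apply: nPk; have [sk s0 s1] := sP k.
have [tk t0 t1] := tP k; apply: dP => //.
by rewrite hk kd invr_gt0 exprn_gt0.
Qed.

Lemma interval_bisection (P : R -> R -> Prop) :
  (forall (x h : R), 0 < h -> P x (h / 2) -> P (x + h / 2) (h / 2) -> P x h) ->
  (forall s : R, 0 <= s <= 1 -> exists2 delta : R, 0 < delta &
    forall (x h : R), 0 < h < delta -> 0 <= x -> x + h <= 1 -> x <= s <= x + h ->
      P x h) ->
  P 0 1.
Proof.
move=> Psplit Ploc; apply: (@square_bisection (fun x _ h => P x h)).
  by move=> x y h h0 P1 P2 _ _; exact: Psplit.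
move=> s t s01 _; have [delta d0 dP] := Ploc s s01.
by exists delta => // x y h ? ? ? _ _ ? _; exact: dP.
Qed.

End Bisection.

Section DyadicMean.
Context {R : realType} {m : nat}.
Implicit Types (f g : R -> 'rV[R[i]]_m) (k : nat).

(** The mean of [f] over the points [j / 2 ^ k], [0 <= j < 2 ^ k].  The
    recursive form makes the self-similarity of the grids a computation. *)
Fixpoint dmean k f : 'rV[R[i]]_m :=
  if k is k'.+1 then
    (2^-1)%:C *: (dmean k' (fun u => f (u / 2)) + dmean k' (fun u => f ((u + 1) / 2)))
  else f 0.

Lemma dmean_eq k f g :
  (forall u : R, 0 <= u < 1 -> f u = g u) -> dmean k f = dmean k g.
Proof.
elim: k f g => [|k IH] f g fg /=; first by apply: fg; rewrite lexx ltr01.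
by congr (_ *: (_ + _)); apply: IH => u u01; apply: fg; lra.
Qed.

Lemma dmeanD k f g : dmean k (fun u => f u + g u) = dmean k f + dmean k g.
Proof.
elim: k f g => [//|k IH] f g /=; rewrite -scalerDr; congr (_ *: _).
by rewrite (IH (fun u => f (u / 2))) (IH (fun u => f ((u + 1) / 2))) addrACA.
Qed.

Lemma dmeanZ k (c : R[i]) f : dmean k (fun u => c *: f u) = c *: dmean k f.
Proof.
elim: k f => [//|k IH] f /=.
rewrite (IH (fun u => f (u / 2))) (IH (fun u => f ((u + 1) / 2))) -scalerDr.
by rewrite !scalerA mulrC.
Qed.

Lemma dmeanN k f : dmean k (fun u => - f u) = - dmean k f.
Proof.
by rewrite -scaleN1r -dmeanZ; congr dmean; apply/funext => u; rewrite scaleN1r.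
Qed.

Lemma dmeanB k f g : dmean k (fun u => f u - g u) = dmean k f - dmean k g.
Proof. by rewrite dmeanD dmeanN. Qed.

Lemma dmean_cst k v : dmean k (fun=> v) = v.
Proof.
elim: k => [//|k /= ->]; rewrite scalerDr -scalerDl -rmorphD /=.
by rewrite (_ : 2^-1 + 2^-1 = 1) ?scale1r//; field.
Qed.

Lemma cabs_half : cabs (2^-1 : R)%:C = 2^-1.
Proof. by rewrite cabs_real ger0_norm. Qed.

Lemma dmean_le k f (M : R) :
  (forall u : R, 0 <= u < 1 -> cnorm (f u) <= M) -> cnorm (dmean k f) <= M.
Proof.
elim: k f => [|k IH] f fM /=; first by apply: fM; rewrite lexx ltr01.
have h1 : cnorm (dmean k (fun u => f (u / 2))) <= M.
  by apply: IH => u u01; apply: fM; lra.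
have h2 : cnorm (dmean k (fun u => f ((u + 1) / 2))) <= M.
  by apply: IH => u u01; apply: fM; lra.
have h3 := cnormD (dmean k (fun u => f (u / 2)))
  (dmean k (fun u => f ((u + 1) / 2))).
by rewrite cnormZ cabs_half; lra.
Qed.

(** On each cell, the finer grid averages the value at the left end with the
    value at the middle. *)
Lemma dmean_lip k f (L : R) :
  (forall (u v : R), 0 <= u <= 1 -> 0 <= v <= 1 ->
    cnorm (f u - f v) <= L * `|u - v|) ->
  cnorm (dmean k.+1 f - dmean k f) <= L * 2 ^- k.
Proof.
elim: k f L => [|k IH] f L fL.
  rewrite /= expr0 invr1 mul0r add0r mulr1.
  have -> : (2^-1)%:C *: (f 0 + f (1 / 2)) - f 0 = (2^-1)%:C *: (f (1 / 2) - f 0).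
    rewrite -{2}(dmean_cst 1 (f 0)) /= -scalerBr; congr (_ *: _).
    by rewrite opprD addrACA subrr add0r.
  have := fL (1 / 2) 0; rewrite subr0 ger0_norm ?divr_ge0// => h.
  have {h} : cnorm (f (1 / 2) - f 0) <= L * (1 / 2) by apply: h; lra.
  have := cnorm_ge0 (f (1 / 2) - f 0).
  by rewrite cnormZ cabs_half; lra.
have h1 : cnorm (dmean k.+1 (fun u => f (u / 2)) -
    dmean k (fun u => f (u / 2))) <= L / 2 * 2 ^- k.
  apply: IH => u v u01 v01; rewrite (le_trans (fL _ _ _ _)) //; try lra.
  by rewrite -mulrBl normrM (ger0_norm (_ : 0 <= 2^-1)) ?invr_ge0//; lra.
have h2 : cnorm (dmean k.+1 (fun u => f ((u + 1) / 2)) -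
    dmean k (fun u => f ((u + 1) / 2))) <= L / 2 * 2 ^- k.
  apply: IH => u v u01 v01; rewrite (le_trans (fL _ _ _ _)) //; try lra.
  by rewrite -mulrBl opprD addrACA subrr addr0 normrM
    (ger0_norm (_ : 0 <= 2^-1)) ?invr_ge0//; lra.
rewrite [dmean k.+2 f]/= [dmean k.+1 f in X in _ - X]/= -/(dmean k.+1 _).
rewrite -[X in cnorm ((2^-1)%:C *: (X + _) - _)]/(dmean k.+1 (fun u => f (u / 2))).
rewrite -[X in cnorm ((2^-1)%:C *: (_ + X) - _)]/(dmean k.+1 (fun u => f ((u + 1) / 2))).
rewrite -scalerBr opprD addrACA cnormZ cabs_half.
have := cnormD (dmean k.+1 (fun u => f (u / 2)) - dmean k (fun u => f (u / 2)))
  (dmean k.+1 (fun u => f ((u + 1) / 2)) - dmean k (fun u => f ((u + 1) / 2))).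
by rewrite exprS invfM; lra.
Qed.

(** The fundamental theorem of calculus.  Halving the interval divides the
    constant of the quadratic remainder by four, while the two halves add up:
    the error is halved with the mesh. *)
Lemma dmean_ftc k f g (L : R) :
  (forall (u v : R), 0 <= u <= 1 -> 0 <= v <= 1 ->
    cnorm (f v - f u - (v - u)%:C *: g u) <= L * (v - u) ^+ 2) ->
  cnorm (dmean k g - (f 1 - f 0)) <= L * 2 ^- k.
Proof.
elim: k f g L => [|k IH] f g L fg.
  rewrite expr0 invr1 /= cnormC.
  have := fg 0 1; rewrite subr0 scale1r expr1n => h; apply: h; lra.
have h1 : cnorm (dmean k (fun u => (2^-1)%:C *: g (u / 2)) - (f (1 / 2) - f 0)) <=
    L / 4 * 2 ^- k.
  have -> : f (1 / 2) - f 0 = f (1 / 2) - f (0 / 2) by rewrite mul0r.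
  apply: (IH (fun u => f (u / 2))) => u v u01 v01.
  rewrite scalerA (_ : _ * _ = (v / 2 - u / 2)%:C).
    by rewrite (le_trans (fg _ _ _ _)) //; lra.
  by rewrite -mulrBl -rmorphM /= mulrC.
have h2 : cnorm (dmean k (fun u => (2^-1)%:C *: g ((u + 1) / 2)) - (f 1 - f (1 / 2))) <=
    L / 4 * 2 ^- k.
  have -> : f 1 - f (1 / 2) = f ((1 + 1) / 2) - f ((0 + 1) / 2).
    by congr (f _ - f _); field.
  apply: (IH (fun u => f ((u + 1) / 2))) => u v u01 v01.
  rewrite scalerA (_ : _ * _ = ((v + 1) / 2 - (u + 1) / 2)%:C).
    by rewrite (le_trans (fg _ _ _ _)) //; lra.
  rewrite -mulrBl opprD addrACA subrr addr0.
  by rewrite -rmorphM /= mulrC.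
rewrite /= scalerDr -!dmeanZ.
rewrite (_ : _ - _ = dmean k (fun u => (2^-1)%:C *: g (u / 2)) - (f (1 / 2) - f 0) +
  (dmean k (fun u => (2^-1)%:C *: g ((u + 1) / 2)) - (f 1 - f (1 / 2)))).
  rewrite (le_trans (cnormD _ _))// exprS invfM; lra.
rewrite addrACA; congr (_ + _); rewrite -opprD; congr (- _).
by rewrite [RHS]addrC addrA subrK.
Qed.

End DyadicMean.

(** * Limits of sequences of complex vectors *)

Section Limits.
Context {R : realType} {m : nat}.
Implicit Types (u : nat -> 'rV[R[i]]_m) (l : 'rV[R[i]]_m) (c : R).

Lemma exp2V_gt0 k : 0 < 2 ^- k :> R.
Proof. by rewrite invr_gt0 exprn_gt0. Qed.

Lemma exp2V_le j k : (j <= k)%N -> 2 ^- k <= 2 ^- j :> R.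
Proof. by move=> jk; rewrite lef_pV2 ?posrE ?exprn_gt0// ler_eXn2l// ltr1n. Qed.

Lemma exp2V_small c (e : R) : 0 < e -> exists k, c * 2 ^- k <= e.
Proof.
move=> e0; have [c0|c0] := leP c 0.
  by exists 0%N; rewrite expr0 invr1 mulr1 (le_trans c0) // ltW.
exists (Num.bound (c / e)); rewrite ler_pdivrMr ?exprn_gt0 // -ler_pdivrMl//.
have ce : 0 <= c / e by rewrite divr_ge0// ltW.
rewrite mulrC (le_trans (ltW (archi_boundP ce))) //.
by rewrite -natrX ler_nat ltnW // ltn_expl.
Qed.

Lemma le_exp2V (a b c : R) :
  (forall k, a <= b + c * 2 ^- k) -> a <= b.
Proof.
move=> abc; apply/ler_addgt0Pr => e e0; have [k ke] := exp2V_small c e0.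
by rewrite (le_trans (abc k)) // lerD2l.
Qed.

Lemma real_cauchy_rate (u : nat -> R) c :
  (forall k, `|u k.+1 - u k| <= c * 2 ^- k) ->
  exists a : R, forall k, `|u k - a| <= 2 * c * 2 ^- k.
Proof.
move=> uc; pose a k := u k - 2 * c * 2 ^- k; pose b k := u k + 2 * c * 2 ^- k.
have step k : a k <= a k.+1 /\ b k.+1 <= b k.
  by have := uc k; rewrite /a /b ler_norml exprS invfM => /andP[]; split; lra.
have c0 : 0 <= c.
  by have := le_trans (normr_ge0 _) (uc 0%N); rewrite expr0 invr1 mulr1.
have ab i j : a i <= b j.
  have aU k : a i <= a (i + k)%N.
    elim: k => [|k IH]; first by rewrite addn0.
    by rewrite addnS (le_trans IH)//; have [] := step (i + k)%N.
  have bD k : b (j + k)%N <= b j.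
    elim: k => [|k IH]; first by rewrite addn0.
    by rewrite addnS (le_trans _ IH)//; have [] := step (j + k)%N.
  rewrite (le_trans (aU j))// (le_trans _ (bD i))// addnC /a /b.
  have := exp2V_gt0 (j + i); have := c0; set h := 2 ^- _; nra.
exists (sup (range a)) => k.
have h1 : a k <= sup (range a).
  by apply: ub_le_sup; [exists (b 0%N) => _ [i _ <-]|exists k].
have h2 : sup (range a) <= b k.
  by apply: ge_sup; [exists (a 0%N), 0%N|move=> _ [i _ <-]].
by move: h1 h2; rewrite /a /b ler_norml => ? ?; apply/andP; split; lra.
Qed.

Lemma cauchy_rate u c : (forall k, cnorm (u k.+1 - u k) <= c * 2 ^- k) ->
  exists l, forall k, cnorm (u k - l) <= 4 * c * 2 ^- k.
Proof.
move=> uc.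
have c0 : 0 <= c.
  by have := le_trans (cnorm_ge0 _) (uc 0%N); rewrite expr0 invr1 mulr1.
have ex j : exists x, forall k, cabs (u k 0 j - x) <= 4 * c * 2 ^- k.
  have [k|a aP] := @real_cauchy_rate (fun k => complex.Re (u k 0 j)) c.
    rewrite (le_trans _ (uc k))// (le_trans _ (cnorm_entry _ j))//.
    by rewrite (le_trans _ (cabs_Re _))// !mxE; case: (u _ 0 j); case: (u _ 0 j).
  have [k|b bP] := @real_cauchy_rate (fun k => complex.Im (u k 0 j)) c.
    rewrite (le_trans _ (uc k))// (le_trans _ (cnorm_entry _ j))//.
    by rewrite (le_trans _ (cabs_Im _))// !mxE; case: (u _ 0 j); case: (u _ 0 j).
  exists (a +i* b) => k; rewrite (le_trans (cabs_le_ReIm _))//.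
  have := aP k; have := bP k; case: (u k 0 j) => x y /=; lra.
have [l lP] := choice ex; exists (\row_j l j) => k; apply/cnormP; split.
  by rewrite !mulr_ge0// ltW// exp2V_gt0.
by move=> j; rewrite !mxE; exact: lP.
Qed.

End Limits.

(** * Complex differentiability *)

Section Small.
Context {R : realType} {U : Type} (N : U -> R).
Hypothesis N_ge0 : forall h, 0 <= N h.

(** [phi h = o(N h)], for vector and for scalar valued [phi]. *)
Definition small m (phi : U -> 'rV[R[i]]_m) :=
  forall e : R, 0 < e -> exists2 delta : R, 0 < delta &
    forall h, N h < delta -> cnorm (phi h) <= e * N h.

Definition smallC (phi : U -> R[i]) :=
  forall e : R, 0 < e -> exists2 delta : R, 0 < delta &
    forall h, N h < delta -> cabs (phi h) <= e * N h.

Lemma smallD m (phi psi : U -> 'rV[R[i]]_m) :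
  small phi -> small psi -> small (fun h => phi h + psi h).
Proof.
move=> sphi spsi e e0.
have [d1 d10 h1] := sphi _ (half_gt0 e0).
have [d2 d20 h2] := spsi _ (half_gt0 e0).
exists (Num.min d1 d2) => [|h]; rewrite lt_min ?d10// => /andP[/h1 k1 /h2 k2].
by rewrite (le_trans (cnormD _ _)) //; lra.
Qed.

Lemma smallZ m (phi : U -> 'rV[R[i]]_m) c :
  small phi -> small (fun h => c *: phi h).
Proof.
move=> sphi e e0; have c0 := cabs_ge0 c.
have [|d d0 hd] := sphi (e / (cabs c + 1)); first by rewrite divr_gt0//; lra.
exists d => // h /hd; rewrite cnormZ => k.
rewrite (le_trans (ler_wpM2l c0 k))// mulrA ler_wpM2r//.
by rewrite mulrCA ler_piMr ?(ltW e0)// ler_pdivrMr; lra.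
Qed.

Lemma eq_small m (phi psi : U -> 'rV[R[i]]_m) :
  phi =1 psi -> small phi -> small psi.
Proof. by move=> /funext->. Qed.

(** The product rule; the remainder of a product is the sum of the three terms
    displayed in the proof. *)
Lemma small_mul m (c : U -> R[i]) (c0 : R[i]) (lc : U -> R[i])
    (f : U -> 'rV[R[i]]_m) (f0 : 'rV[R[i]]_m) (lf : U -> 'rV[R[i]]_m)
    (a b : R) :
  0 <= a -> 0 <= b ->
  (forall h, cabs (lc h) <= a * N h) -> (forall h, cnorm (lf h) <= b * N h) ->
  smallC (fun h => c h - c0 - lc h) -> small (fun h => f h - f0 - lf h) ->
  small (fun h => c h *: f h - c0 *: f0 - (lc h *: f0 + c0 *: lf h)).
Proof.
move=> a0 b0 lca lfb sc sf e e0.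
pose B := (cnorm f0 + b + 1) + (cabs c0 + a) + a * b.
have nf0 := cnorm_ge0 f0; have nc0 := cabs_ge0 c0.
have ab0 := mulr_ge0 a0 b0.
have B1 : 1 <= B by rewrite /B; lra.
have [e' [e'0 e'1 eB]] : exists e' : R, [/\ 0 < e', e' <= 1 & e' * B <= e].
  exists (Num.min 1 (e / B)); split; last 2 first.
  - by rewrite ge_min lexx.
  - by rewrite -ler_pdivlMr ?ge_min ?lexx ?orbT//; lra.
  - by rewrite lt_min ltr01 divr_gt0//; lra.
have [d1 d10 h1] := sc _ e'0; have [d2 d20 h2] := sf _ e'0.
exists (Num.min (Num.min d1 d2) e') => [|h].
  by rewrite !lt_min d10 d20 e'0.
rewrite !lt_min => /andP[/andP[/h1 {}h1 /h2 {}h2] he].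
have nh := N_ge0 h.
have -> : c h *: f h - c0 *: f0 - (lc h *: f0 + c0 *: lf h) =
    (c h - c0 - lc h) *: f h + (c0 + lc h) *: (f h - f0 - lf h) +
    lc h *: lf h.
  by coordinates; ring.
have nfh : cnorm (f h) <= cnorm f0 + b + 1.
  have -> : f h = f0 + lf h + (f h - f0 - lf h).
    by coordinates; ring.
  have k1 := cnormD (f0 + lf h) (f h - f0 - lf h).
  have k2 := cnormD f0 (lf h); have k3 := lfb h; nra.
have nch : cabs (c0 + lc h) <= cabs c0 + a.
  by have k1 := cabsD c0 (lc h); have k2 := lca h; nra.
have t1 : cnorm ((c h - c0 - lc h) *: f h) <= e' * N h * (cnorm f0 + b + 1).
  by rewrite cnormZ ler_pM ?cabs_ge0 ?cnorm_ge0.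
have t2 : cnorm ((c0 + lc h) *: (f h - f0 - lf h)) <= (cabs c0 + a) * (e' * N h).
  by rewrite cnormZ ler_pM ?cabs_ge0 ?cnorm_ge0.
have t3 : cnorm (lc h *: lf h) <= a * b * (e' * N h).
  rewrite cnormZ (le_trans (ler_pM (cabs_ge0 _) (cnorm_ge0 _) (lca h) (lfb h)))//.
  by rewrite mulrACA ler_wpM2l// ler_wpM2r// ltW.
rewrite (le_trans (cnormD _ _))// (le_trans (lerD (cnormD _ _) (lexx _)))//.
apply: (@le_trans _ _ (e' * B * N h)); last by rewrite ler_wpM2r.
rewrite /B; lra.
Qed.

End Small.

Section OneVariable.
Context {R : realType}.
Implicit Types (z w k : R[i]).

Definition cdiff m (f : R[i] -> 'rV[R[i]]_m) z (A : 'rV[R[i]]_m) :=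
  small (@cabs R) (fun k => f (z + k) - f z - k *: A).

Definition cdiffC (c : R[i] -> R[i]) z (a : R[i]) :=
  smallC (@cabs R) (fun k => c (z + k) - c z - k * a).

Lemma cdiff_comp m (c : R[i] -> R[i]) (f : R[i] -> 'rV[R[i]]_m) z a A :
  cdiffC c z a -> cdiff f (c z) A -> cdiff (f \o c) z (a *: A).
Proof.
move=> dc df e e0; have na := cabs_ge0 a; have nA := cnorm_ge0 A.
have [|d1 d10 h1] := df (e / 2 / (cabs a + 1)).
  by rewrite divr_gt0 ?half_gt0//; lra.
have [|d2 d20 h2] := dc (Num.min 1 (e / 2 / (cnorm A + 1))).
  by rewrite lt_min ltr01 divr_gt0 ?half_gt0//; lra.
exists (Num.min d2 (d1 / (cabs a + 1))) => [|k].
  by rewrite lt_min d20 divr_gt0//; lra.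
rewrite lt_min => /andP[/h2 {}h2]; rewrite ltr_pdivlMr ?ltr_wpDl// => kd.
have nk := cabs_ge0 k.
have ck1 : cabs (c (z + k) - c z) <= (cabs a + 1) * cabs k.
  have -> : c (z + k) - c z = (c (z + k) - c z - k * a) + k * a by ring.
  rewrite (le_trans (cabsD _ _))// cabsM.
  have : cabs (c (z + k) - c z - k * a) <= cabs k.
    by rewrite (le_trans h2)// -[leRHS]mul1r ler_wpM2r// ge_min lexx.
  lra.
have := h1 (c (z + k) - c z); rewrite subrKC => {}h1.
have {}h1 : cnorm (f (c (z + k)) - f (c z) - (c (z + k) - c z) *: A) <=
    e / 2 * cabs k.
  rewrite (le_trans (h1 _))//; first by rewrite (le_lt_trans ck1)// mulrC.
  rewrite (le_trans (ler_wpM2l _ ck1))//.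
    by rewrite divr_ge0// ?(ltW (half_gt0 e0))//; lra.
  by rewrite mulrA divfK ?gt_eqF//; lra.
have -> : (f \o c) (z + k) - (f \o c) z - k *: (a *: A) =
   (f (c (z + k)) - f (c z) - (c (z + k) - c z) *: A) +
   (c (z + k) - c z - k * a) *: A.
  by coordinates; ring.
rewrite (le_trans (cnormD _ _))// cnormZ.
have : cabs (c (z + k) - c z - k * a) * cnorm A <= e / 2 * cabs k.
  rewrite (le_trans (ler_wpM2r nA h2))// mulrAC ler_wpM2r//.
  have : Num.min 1 (e / 2 / (cnorm A + 1)) <= e / 2 / (cnorm A + 1).
    by rewrite ge_min lexx orbT.
  move=> /(ler_wpM2r nA)/le_trans; apply; rewrite mulrAC ler_pdivrMr; nra.
lra.
Qed.

Lemma cdiff_mul m (c : R[i] -> R[i]) (f : R[i] -> 'rV[R[i]]_m) z a A :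
  cdiffC c z a -> cdiff f z A ->
  cdiff (fun w => c w *: f w) z (a *: f z + c z *: A).
Proof.
move=> dc df.
have := @small_mul R R[i] (@cabs R) (@cabs_ge0 R) m
  (fun k => c (z + k)) (c z) (fun k => k * a)
  (fun k => f (z + k)) (f z) (fun k => k *: A) (cabs a) (cnorm A)
  (cabs_ge0 _) (cnorm_ge0 _) _ _ dc df.
have h1 k : cabs (k * a) <= cabs a * cabs k by rewrite cabsM mulrC.
have h2 k : cnorm (k *: A) <= cnorm A * cabs k by rewrite cnormZ mulrC.
move=> /(_ h1 h2); apply: eq_small => k /=; congr (_ - _).
by rewrite scalerDr !scalerA (mulrC (c z)).
Qed.

End OneVariable.

(** * Goursat's lemma on the unit square *)

Section Goursat.
Context {R : realType} {m : nat}.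
Implicit Types (g : R -> R -> 'rV[R[i]]_m) (x y h : R) (k : nat).

(** The contour integral of [g] along the boundary of the square
    [x, x + h] x [y, y + h], with dyadic means on the four edges. *)
Definition contour k g x y h : 'rV[R[i]]_m :=
  h%:C *: (dmean k (fun u => g (x + h * u) y) +
    'i *: dmean k (fun u => g (x + h) (y + h * u)) -
    dmean k (fun u => g (x + h * u) (y + h)) -
    'i *: dmean k (fun u => g x (y + h * u))).

(** The inner edges cancel, and the grid of level [k.+1] on an outer edge
    consists of the grids of level [k] on its halves. *)
Lemma contour_split k g x y h : contour k.+1 g x y h =
  contour k g x y (h / 2) + contour k g (x + h / 2) y (h / 2) +
  contour k g x (y + h / 2) (h / 2) +
  contour k g (x + h / 2) (y + h / 2) (h / 2).
Proof.
have hor b : dmean k.+1 (fun u => g (x + h * u) b) = (2^-1)%:C *: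
    (dmean k (fun u => g (x + h / 2 * u) b) +
     dmean k (fun u => g (x + h / 2 + h / 2 * u) b)).
  by rewrite /=; congr (_ *: (_ + _)); apply: dmean_eq => t _; congr (g _ _);
    field.
have ver a : dmean k.+1 (fun u => g a (y + h * u)) = (2^-1)%:C *:
    (dmean k (fun u => g a (y + h / 2 * u)) +
     dmean k (fun u => g a (y + h / 2 + h / 2 * u))).
  by rewrite /=; congr (_ *: (_ + _)); apply: dmean_eq => t _; congr (g _ _);
    field.
rewrite /contour !hor !ver.
have -> : x + h / 2 + h / 2 = x + h by field.
have -> : y + h / 2 + h / 2 = y + h by field.
have -> : (h / 2)%:C = h%:C * (2^-1)%:C by rewrite -rmorphM.
do ![move: (dmean k _) => ?].
by coordinates; ring.
Qed.

(** Opposite edges carry the same Riemann sum of an affine function up to a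
    constant, and the constants cancel; so this holds on every grid. *)
Lemma contour_affine k (v A : 'rV[R[i]]_m) x y h :
  contour k (fun a b => v + (a%:C + 'i * b%:C) *: A) x y h = 0.
Proof.
rewrite /contour; pose I := dmean k (fun u : R => u%:C *: A).
have hor b : dmean k (fun u => v + ((x + h * u)%:C + 'i * b%:C) *: A) =
    v + (x%:C + 'i * b%:C) *: A + h%:C *: I.
  rewrite /I -dmeanZ -(dmean_cst k (v + (x%:C + 'i * b%:C) *: A)) -dmeanD.
  apply: dmean_eq => u _; by coordinates; rewrite rmorphD rmorphM /=; ring.
have ver a : dmean k (fun u => v + (a%:C + 'i * (y + h * u)%:C) *: A) =
    v + (a%:C + 'i * y%:C) *: A + 'i *: (h%:C *: I).
  rewrite /I -!dmeanZ -(dmean_cst k (v + (a%:C + 'i * y%:C) *: A)) -dmeanD.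
  apply: dmean_eq => u _; by coordinates; rewrite rmorphD rmorphM /=; ring.
have xh : (x + h)%:C = x%:C + h%:C by rewrite rmorphD.
have yh : (y + h)%:C = y%:C + h%:C by rewrite rmorphD.
have i2 : 'i * 'i = -1 :> R[i] by rewrite -expr2 sqr_i.
rewrite (hor y) (hor (y + h)) (ver x) (ver (x + h)) xh yh.
rewrite -[RHS](scaler0 _ h%:C); congr (_ *: _).
by coordinates; ring: i2.
Qed.

Lemma contourB k g1 g2 x y h :
  contour k (fun a b => g1 a b - g2 a b) x y h =
  contour k g1 x y h - contour k g2 x y h.
Proof.
rewrite /contour !dmeanB; do ![move: (dmean k _) => ?].
by coordinates; ring.
Qed.

Lemma contour_le k g x y h M : 0 <= h ->
  (forall (a b : R), x <= a <= x + h -> y <= b <= y + h -> cnorm (g a b) <= M) ->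
  cnorm (contour k g x y h) <= 4 * h * M.
Proof.
move=> h0 gM.
have bnd (p : R -> 'rV[R[i]]_m) :
  (forall u : R, 0 <= u < 1 -> cnorm (p u) <= M) ->
  cnorm (dmean k p) <= M by exact: dmean_le.
have e1 : cnorm (dmean k (fun u => g (x + h * u) y)) <= M.
  by apply: bnd => u u01; apply: gM; nra.
have e2 : cnorm ('i *: dmean k (fun u => g (x + h) (y + h * u))) <= M.
  by rewrite cnormZ cabs_i mul1r; apply: bnd => u u01; apply: gM; nra.
have e3 : cnorm (dmean k (fun u => g (x + h * u) (y + h))) <= M.
  by apply: bnd => u u01; apply: gM; nra.
have e4 : cnorm ('i *: dmean k (fun u => g x (y + h * u))) <= M.
  by rewrite cnormZ cabs_i mul1r; apply: bnd => u u01; apply: gM; nra.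
rewrite /contour cnormZ cabs_real ger0_norm// (mulrC 4) -mulrA ler_wpM2l//.
have -> : 4 * M = M + M + M + M by ring.
exact: cnormB_le (cnormB_le (cnormD_le e1 e2) e3) e4.
Qed.

(** Goursat's argument: the bound [e * h ^ 2] on the contour integral is
    additive under quartering, and holds for the small squares around a point
    because [g] differs there from an affine function by [o(h)]. *)
Lemma goursat g :
  (forall (s t : R), 0 <= s <= 1 -> 0 <= t <= 1 ->
    exists A : 'rV[R[i]]_m, forall e : R,
    0 < e ->
    exists2 delta : R, 0 < delta & forall (x y : R), 0 <= x <= 1 -> 0 <= y <= 1 ->
      `|x - s| < delta -> `|y - t| < delta ->
      cnorm (g x y - g s t - ((x - s)%:C + 'i * (y - t)%:C) *: A) <=
        e * (`|x - s| + `|y - t|)) ->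
  forall e : R, 0 < e -> exists K, forall k, (K <= k)%N ->
    cnorm (contour k g 0 0 1) <= e.
Proof.
move=> gd e e0.
suff [K KP] : exists K, forall k, (K <= k)%N ->
    cnorm (contour k g 0 0 1) <= e * 1 ^+ 2.
  by exists K => k /KP; rewrite expr1n mulr1.
apply: (@square_bisection R (fun x y h => exists K, forall k, (K <= k)%N ->
    cnorm (contour k g x y h) <= e * h ^+ 2)) => [x y h h0|s t s01 t01].
  move=> [K1 K1P] [K2 K2P] [K3 K3P] [K4 K4P].
  exists (maxn (maxn K1 K2) (maxn K3 K4)).+1 => -[//|k].
  rewrite ltnS !geq_max => /andP[/andP[/K1P k1 /K2P k2] /andP[/K3P k3 /K4P k4]].
  rewrite contour_split.
  apply: le_trans (cnormD_le (cnormD_le (cnormD_le k1 k2) k3) k4) _.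
  by clear; rewrite expr_div_n; lra.
have [A AP] := gd s t s01 t01.
have [|delta d0 dP] := AP (e / 8); first by rewrite divr_gt0.
exists delta => // x y h /andP[h0 hd] x0 x1 y0 y1 xs yt; exists 0%N => k _.
pose L (a b : R) := (g s t - (s%:C + 'i * t%:C) *: A) + (a%:C + 'i * b%:C) *: A.
rewrite -[contour _ _ _ _ _]subr0.
rewrite -(contour_affine k (g s t - (s%:C + 'i * t%:C) *: A) A x y h) -contourB.
rewrite (le_trans (@contour_le _ _ _ _ _ (e / 8 * (h + h)) (ltW h0) _))//.
  move=> a b xa yb; have -> : g a b - L a b =
      g a b - g s t - ((a - s)%:C + 'i * (b - t)%:C) *: A.
    by rewrite /L; coordinates; rewrite !rmorphB /=; ring.
  have as_ : `|a - s| <= h by rewrite ler_norml; lra.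
  have bt_ : `|b - t| <= h by rewrite ler_norml; lra.
  rewrite (le_trans (dP _ _ _ _ _ _))//; try lra.
  by rewrite ler_wpM2l ?lerD// divr_ge0// ltW.
by clear; rewrite expr2; lra.
Qed.

End Goursat.

(** * The periodic exponential *)

Section Exponential.
Context {R : realType}.
Implicit Types (z w k : R[i]).

Lemma Re_cartesian (x y : R) : complex.Re (x%:C + 'i * y%:C) = x.
Proof. by rewrite /= !mul0r mul1r subr0 addr0. Qed.

Lemma is_derive_small (f : R -> R) (df : R) : is_derive (0 : R) 1 f df ->
  forall e : R, 0 < e -> exists2 d : R, 0 < d &
    forall t, `|t| < d -> `|f t - f 0 - t * df| <= e * `|t|.
Proof.
move=> [/derivable_nbhs /eqaddoP fd dfE] e e0.
have /nbhs_ballP [d d0 dP] := fd e e0.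
exists d => // t td; have := dP t.
rewrite /ball /= sub0r normrN => /(_ td); rewrite dfE /=.
by rewrite !fctE addr0 /GRing.scale /= mulr1 opprD addrA.
Qed.

(** [exp (2 * pi * w)]. *)
Definition cexp2pi w : R[i] :=
  (expR (pi *+ 2 * complex.Re w))%:C *
  (cos (pi *+ 2 * complex.Im w) +i* sin (pi *+ 2 * complex.Im w)).

Lemma cexp2piD z w : cexp2pi (z + w) = cexp2pi z * cexp2pi w.
Proof.
case: z w => a b [c d]; rewrite /cexp2pi /= !mulrDr expRD cosD sinD.
by apply/eqP; rewrite eq_complex /=; apply/andP; split; apply/eqP; ring.
Qed.

Lemma cexp2pi0 : cexp2pi 0 = 1.
Proof. by rewrite /cexp2pi /= !mulr0 expR0 cos0 sin0 mul1r. Qed.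

Lemma cexp2piN w : cexp2pi (- w) * cexp2pi w = 1.
Proof. by rewrite -cexp2piD addNr cexp2pi0. Qed.

Lemma cexp2pi_i : cexp2pi 'i = 1.
Proof. by rewrite /cexp2pi /= mulr0 mulr1 expR0 cos2pi sin2pi mul1r. Qed.

Lemma cabs_cexp2pi w : cabs (cexp2pi w) = expR (pi *+ 2 * complex.Re w).
Proof.
rewrite cabsM cabs_real ger0_norm ?expR_ge0// cabs_def /=.
by rewrite cos2Dsin2 sqrtr1 mulr1.
Qed.

Lemma cexp2pi_cdiff0 : cdiffC cexp2pi 0 (pi *+ 2)%:C.
Proof.
move=> e e0; pose p : R := pi *+ 2.
have p0 : 0 < p by rewrite pmulrn_lgt0// pi_gt0.
have [e' [e'0 e'1 e'p]] : exists e' : R, [/\ 0 < e', e' <= 1 & 14 * p * e' <= e].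
  exists (Num.min 1 (e / (14 * p))); split; last 2 first.
  - by rewrite ge_min lexx.
  - rewrite -ler_pdivlMl ?mulr_gt0//.
    by rewrite [leRHS]mulrC ge_min lexx orbT.
  - by rewrite lt_min ltr01 divr_gt0// mulr_gt0.
have [d1 d10 h1] := is_derive_small (is_derive_expR 0) e'0.
have [d2 d20 h2] := is_derive_small (is_derive_sin 0) e'0.
have [d3 d30 h3] := is_derive_small (is_derive_cos 0) e'0.
exists (Num.min (Num.min d1 d2) (Num.min d3 e') / p) => [|k].
  by rewrite divr_gt0// !lt_min d10 d20 d30 e'0.
rewrite ltr_pdivlMr// => kd.
have [] : `|p * complex.Re k| <= p * cabs k /\ `|p * complex.Im k| <= p * cabs k.
  by rewrite !normrM (gtr0_norm p0) !ler_wpM2l ?cabs_Re ?cabs_Im// ltW.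
rewrite add0r cexp2pi0.
have -> : cexp2pi k - 1 - k * p%:C =
  (expR (p * complex.Re k) * cos (p * complex.Im k) - 1 - p * complex.Re k) +i*
  (expR (p * complex.Re k) * sin (p * complex.Im k) - p * complex.Im k).
  case: {kd} k => a b; rewrite /cexp2pi /=.
  by apply/eqP; rewrite eq_complex /=; apply/andP; split; apply/eqP; ring.
move: (p * complex.Re k) (p * complex.Im k) => a b ak bk.
move: kd; rewrite mulrC !lt_min => /andP[/andP[k1 k2] /andP[k3 k4]].
have := h1 a (le_lt_trans ak k1); have := h2 b (le_lt_trans bk k2).
have := h3 b (le_lt_trans bk k3).
rewrite expR0 sin0 cos0 !subr0 oppr0 !mulr0 !mulr1 !subr0.
set E := expR a; set C := cos b; set S := sin b => hC hS hE.
have ae : `|a| <= e' by lra.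
have C1 : `|C| <= 1 := cos_max b.
have a0 := normr_ge0 a; have b0 := normr_ge0 b.
have re : `|E * C - 1 - a| <= 3 * e' * (p * cabs k).
  have -> : E * C - 1 - a = (E - 1 - a) * C + (1 + a) * (C - 1) by ring.
  have t1 : `|(E - 1 - a) * C| <= e' * `|a|.
    by rewrite normrM (le_trans (ler_wpM2l (normr_ge0 _) C1))// mulr1.
  have t2 : `|(1 + a) * (C - 1)| <= 2 * (e' * `|b|).
    rewrite normrM ler_pM// (le_trans (ler_normD _ _))// normr1; lra.
  rewrite (le_trans (ler_normD _ _))//; nra.
have im : `|E * S - b| <= 6 * e' * (p * cabs k).
  have -> : E * S - b = (E - 1 - a) * S + a * S + (S - b) by ring.
  have S1 : `|S| <= 2 * `|b|.
    have -> : S = (S - b) + b by ring.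
    rewrite (le_trans (ler_normD _ _))//; nra.
  have t1 : `|(E - 1 - a) * S| <= (e' * `|a|) * (2 * `|b|).
    by rewrite normrM ler_pM.
  have t2 : `|a * S| <= `|a| * (2 * `|b|) by rewrite normrM ler_pM.
  rewrite (le_trans (ler_normD _ _))// (le_trans (lerD (ler_normD _ _) (lexx _)))//.
  have t3 : e' * `|a| <= e' by rewrite ler_piMr ?(ltW e'0)// (le_trans ae).
  have t4 : e' * `|a| * (2 * `|b|) <= e' * (2 * `|b|).
    by rewrite ler_wpM2r// mulr_ge0.
  have t5 : `|a| * (2 * `|b|) <= e' * (2 * `|b|).
    by rewrite ler_wpM2r// mulr_ge0.
  have t6 : e' * `|b| <= e' * (p * cabs k).
    by rewrite ler_wpM2l// ltW.
  have t7 : 0 <= e' * `|b| by rewrite mulr_ge0// ltW.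
  lra.
(* The real and the imaginary part contribute 3 and 6 to the constant, which
   14 dominates. *)
rewrite (le_trans (cabs_le_ReIm _))//=.
have := cabs_ge0 k; have : e' * (p * cabs k) = e' * p * cabs k by ring.
nra.
Qed.

Lemma cexp2pi_cdiff w : cdiffC cexp2pi w (cexp2pi w * (pi *+ 2)%:C).
Proof.
move=> e e0; have c0 : 0 < cabs (cexp2pi w) by rewrite cabs_cexp2pi expR_gt0.
have [|d d0 dP] := cexp2pi_cdiff0 (e := e / cabs (cexp2pi w)).
  by rewrite divr_gt0.
exists d => // k /dP; rewrite add0r cexp2pi0 => h.
have -> : cexp2pi (w + k) - cexp2pi w - k * (cexp2pi w * (pi *+ 2)%:C) =
  cexp2pi w * (cexp2pi k - 1 - k * (pi *+ 2)%:C) by rewrite cexp2piD; ring.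
rewrite cabsM (le_trans (ler_wpM2l (cabs_ge0 _) h))//.
by rewrite mulrA [_ * (e / _)]mulrC divfK// gt_eqF.
Qed.

Lemma cdiffCZ (c : R[i] -> R[i]) z a (b : R[i]) :
  cdiffC c z a -> cdiffC (fun w => b * c w) z (b * a).
Proof.
move=> dc e e0; have nb := cabs_ge0 b.
have [|d d0 dP] := dc (e / (cabs b + 1)); first by rewrite divr_gt0//; lra.
exists d => // k /dP h; have -> : b * c (z + k) - b * c z - k * (b * a) =
  b * (c (z + k) - c z - k * a) by ring.
rewrite cabsM (le_trans (ler_wpM2l nb h))// mulrA ler_wpM2r ?cabs_ge0//.
by rewrite mulrCA ler_piMr ?(ltW e0)// ler_pdivrMr; lra.
Qed.

Lemma cdiffC_opp (c : R[i] -> R[i]) z a :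
  cdiffC c (- z) a -> cdiffC (fun w => c (- w)) z (- a).
Proof.
move=> dc e /dc [d d0 dP]; exists d => // k kd.
have := dP (- k); rewrite cabsN -opprD => /(_ kd).
by rewrite mulNr mulrN.
Qed.

End Exponential.

(** * Cauchy's estimate *)

Section Cauchy.
Context {R : realType} {m : nat}.
Implicit Types (f : R[i] -> 'rV[R[i]]_m) (z w : R[i]) (r M : R).

(** The function [f z / z] is holomorphic in the logarithmic coordinate
    [z = r * cexp2pi w].  There Goursat's lemma applies to unit squares, whose
    horizontal edges cancel by periodicity; so the mean of [f z / z] over the
    circle of radius [r] is the mean over arbitrarily small circles, which
    tends to the derivative of [f] at [0]. *)
Lemma schwarz_estimate f A r M : 0 < r -> f 0 = 0 ->
  (forall z, cabs z <= r -> exists B, cdiff f z B) ->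
  (forall z, cabs z <= r -> cnorm (f z) <= M) ->
  cdiff f 0 A -> cnorm A <= M / r.
Proof.
move=> r0 f0 fd fM fA.
have rC : (r^-1)%:C * r%:C = 1 :> R[i] by rewrite -rmorphM /= mulVf ?gt_eqF.
pose G w := ((r^-1)%:C * cexp2pi (- w)) *: f (r%:C * cexp2pi w).
have p0 : 0 < pi *+ 2 :> R by rewrite pmulrn_lgt0// pi_gt0.
have absr w : cabs (r%:C * cexp2pi w) = r * expR (pi *+ 2 * complex.Re w).
  by rewrite cabsM cabs_real cabs_cexp2pi ger0_norm// ltW.
have absV w : cabs ((r^-1)%:C * cexp2pi (- w)) =
    (r * expR (pi *+ 2 * complex.Re w))^-1.
  rewrite cabsM cabs_real cabs_cexp2pi ger0_norm ?invr_ge0 ?ltW// invfM -expRN.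
  by rewrite raddfN mulrN.
have left_ w : complex.Re w <= 0 -> cabs (r%:C * cexp2pi w) <= r.
  move=> w0; rewrite absr ler_piMr ?(ltW r0)// -expR0 ler_expR.
  by rewrite mulr_ge0_le0// ltW.
have Gd w : complex.Re w <= 0 -> exists B, cdiff G w B.
  move=> w0; have [B dB] := fd _ (left_ w w0).
  have dc := cdiffCZ r%:C (cexp2pi_cdiff w).
  have dV := cdiffCZ (r^-1)%:C (cdiffC_opp (cexp2pi_cdiff (- w))).
  by have := cdiff_mul dV (cdiff_comp dc dB); eexists; eassumption.
have Gper (x : R) : G (x%:C + 'i * 1%:C) = G (x%:C + 'i * 0%:C).
  rewrite mulr0 mulr1 addr0 /G opprD !cexp2piD cexp2pi_i mulr1.
  suff -> : cexp2pi (- 'i) = 1 :> R[i] by rewrite mulr1.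
  by have := @cexp2piN R 'i; rewrite cexp2pi_i mulr1.
pose mean k (j : R) := dmean k (fun u => G (j%:C + 'i * u%:C)).
have meanS (j : nat) (e : R) : 0 < e -> exists K, forall k, (K <= k)%N ->
    cnorm (mean k (- j%:R) - mean k (- j.+1%:R)) <= e.
  move=> e0; pose a : R := - j.+1%:R.
  have [|K KP] := @goursat R m (fun x y => G ((a + x)%:C + 'i * y%:C)) _ e e0.
    move=> s t s01 t01; have [|B dB] := Gd ((a + s)%:C + 'i * t%:C).
      by rewrite Re_cartesian /a -natr1; have := ler0n R j; lra.
    exists B => e1 e10; have [d d0 dP] := dB (e1) e10.
    exists (d / 2) => [|x y _ _ xs yt]; first exact: half_gt0.
    have h : cabs ((x - s)%:C + 'i * (y - t)%:C) <= `|x - s| + `|y - t|.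
      by rewrite (le_trans (cabsD _ _))// cabsM cabs_i mul1r !cabs_real.
    have := dP ((x - s)%:C + 'i * (y - t)%:C).
    have -> : (a + s)%:C + 'i * t%:C + ((x - s)%:C + 'i * (y - t)%:C) =
        (a + x)%:C + 'i * y%:C by rewrite !(rmorphD, rmorphB) /=; ring.
    move=> k1; rewrite (le_trans (k1 _))//; first by rewrite (le_lt_trans h)//; lra.
    by rewrite ler_wpM2l// ltW.
  exists K => k /KP; rewrite /contour scale1r /=.
  have -> : dmean k (fun u : R => G ((a + (0 + 1 * u))%:C + 'i * (0 + 1)%:C)) =
      dmean k (fun u : R => G ((a + (0 + 1 * u))%:C + 'i * 0%:C)).
    by apply: dmean_eq => u _; rewrite -Gper (add0r (1 : R)).
  rewrite [X in X - _ - _]addrC addrK -scalerBr cnormZ cabs_i mul1r.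
  have -> : mean k (- j%:R) =
      dmean k (fun u => G ((a + (0 + 1))%:C + 'i * (0 + 1 * u)%:C)).
    by apply: dmean_eq => u _; rewrite !add0r mul1r /a -natr1 opprD subrK.
  have -> : mean k (- j.+1%:R) =
      dmean k (fun u => G ((a + 0)%:C + 'i * (0 + 1 * u)%:C)).
    by apply: dmean_eq => u _; rewrite add0r mul1r addr0.
  by [].
have meanN (j : nat) (e : R) : 0 < e -> exists K, forall k, (K <= k)%N ->
    cnorm (mean k 0 - mean k (- j%:R)) <= e.
  elim: j e => [|j IH] e e0.
    by exists 0%N => k _; rewrite oppr0 subrr cnorm0 ltW.
  have [K1 K1P] := IH _ (half_gt0 e0); have [K2 K2P] := meanS j _ (half_gt0 e0).
  exists (maxn K1 K2) => k; rewrite geq_max => /andP[/K1P k1 /K2P k2].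
  have := lerD k1 k2; rewrite -splitr.
  exact: le_trans (cnorm_tri (mean k (- j%:R)) _ _).
have mean0 k : cnorm (mean k 0) <= M / r.
  apply: dmean_le => u _; rewrite cnormZ absV Re_cartesian mulr0 expR0 mulr1.
  rewrite mulrC ler_wpM2r ?invr_ge0 ?(ltW r0)// fM//.
  by apply: left_; rewrite Re_cartesian.
apply/ler_addgt0Pr => e e0.
have [d d0 dP] := fA _ (half_gt0 e0).
have [j jd] : exists j : nat, r * expR (pi *+ 2 * (- j%:R)) < d.
  exists (Num.bound (r / d / (pi *+ 2))).
  have b0 : 0 <= r / d / (pi *+ 2) :> R by rewrite !divr_ge0// ltW.
  have := archi_boundP b0; rewrite ltr_pdivrMr// => h.
  rewrite mulrN expRN ltr_pdivrMr ?expR_gt0// mulrC -ltr_pdivrMr//.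
  by rewrite (lt_le_trans h)// mulrC (le_trans _ (expR_ge1Dx _))// lerDr.
have [K KP] := meanN j _ (half_gt0 e0).
have meanA : cnorm (mean K (- j%:R) - A) <= e / 2.
  rewrite -{1}(dmean_cst K A) -dmeanB; apply: dmean_le => u _.
  rewrite /G; set w := (- j%:R)%:C + _.
  have Rew : complex.Re w = - j%:R by rewrite Re_cartesian.
  have wd : cabs (r%:C * cexp2pi w) < d by rewrite absr Rew.
  have := dP _ wd; rewrite add0r f0 subr0 => h.
  have -> : ((r^-1)%:C * cexp2pi (- w)) *: f (r%:C * cexp2pi w) - A =
    ((r^-1)%:C * cexp2pi (- w)) *: (f (r%:C * cexp2pi w) - (r%:C * cexp2pi w) *: A).
    by rewrite scalerBr scalerA mulrACA cexp2piN rC mulr1 scale1r.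
  rewrite cnormZ (le_trans (ler_wpM2l (cabs_ge0 _) h))// absV absr mulrCA.
  by rewrite mulVf ?mulr1// gt_eqF// mulr_gt0// expR_gt0.
have -> : A = mean K 0 - (mean K 0 - mean K (- j%:R)) - (mean K (- j%:R) - A).
  by coordinates; ring.
apply: le_trans (cnormB_le (cnormB_le (mean0 K) (KP K (leqnn K))) meanA) _.
by clear; lra.
Qed.

(** The odd part of [f] has the same derivative at [0] and satisfies the
    same bound. *)
Lemma cauchy_estimate1 f A r M : 0 < r ->
  (forall z, cabs z <= r -> exists B, cdiff f z B) ->
  (forall z, cabs z <= r -> cnorm (f z) <= M) ->
  cdiff f 0 A -> cnorm A <= M / r.
Proof.
move=> r0 fd fM fA.
have oppd z B : cdiff f (- z) B -> cdiff (fun w => f (- w)) z (- B).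
  move=> dB e /dB [d d0 dP]; exists d => // k kd.
  have := dP (- k); rewrite cabsN -opprD => /(_ kd).
  by rewrite scaleNr scalerN.
have oddd z B C : cdiff f z B -> cdiff f (- z) C ->
    cdiff (fun w => (2^-1)%:C *: (f w - f (- w))) z ((2^-1)%:C *: (B + C)).
  move=> dB /oppd dC.
  have := smallZ (@cabs_ge0 R) (2^-1)%:C
    (smallD dB (smallZ (@cabs_ge0 R) (-1) dC)).
  by apply: eq_small => k; coordinates; ring.
apply: (@schwarz_estimate (fun w => (2^-1)%:C *: (f w - f (- w))) A r M r0).
- by rewrite oppr0 subrr scaler0.
- move=> z zr; have [B dB] := fd _ zr.
  have [|C dC] := fd (- z); first by rewrite cabsN.
  by exists ((2^-1)%:C *: (B + C)); exact: oddd.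
- move=> z zr; rewrite cnormZ cabs_half.
  have := cnormB (f z) (f (- z)); have := fM _ zr.
  by have := fM (- z); rewrite cabsN => /(_ zr); lra.
- have -> : A = (2^-1)%:C *: (A + A).
    rewrite scalerDr -scalerDl -rmorphD /= (_ : 2^-1 + 2^-1 = 1) ?scale1r//.
    by field.
  by apply: oddd; rewrite // oppr0.
Qed.

End Cauchy.

(** * Complex differentiability in several variables *)

(** The Jacobian matrix, sealed: it is only known through [cderiv]. *)
HB.lock Definition jac {R : realType} {n m : nat}
  (F : 'rV[R[i]]_n -> 'rV[R[i]]_m) (z : 'rV[R[i]]_n) : 'M[R[i]]_(n, m) := 'J F z.

Section CDeriv.
Context {R : realType} {n m : nat}.
Implicit Types (z w h v : 'rV[R[i]]_n) (F G : 'rV[R[i]]_n -> 'rV[R[i]]_m).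
Implicit Types (J : 'M[R[i]]_(n, m)).

Lemma cnorm_sum_le (I : finType) (f : I -> 'rV[R[i]]_m) (B : R) :
  (forall i, cnorm (f i) <= B) -> cnorm (\sum_i f i) <= #|I|%:R * B.
Proof.
move=> fB; rewrite mulr_natl -sumr_const.
apply: (big_ind2 (fun x (y : R) => cnorm x <= y)) => //; first by rewrite cnorm0.
by move=> x1 x2 y1 y2; exact: cnormD_le.
Qed.

Lemma cnorm_mulmx_rows v J (B : R) : (forall i, cnorm (row i J) <= B) ->
  cnorm (v *m J) <= n%:R * (B * cnorm v).
Proof.
move=> JB; rewrite mulmx_sum_row.
have := @cnorm_sum_le 'I_n (fun i => v 0 i *: row i J) (B * cnorm v).
rewrite card_ord; apply=> i; rewrite cnormZ mulrC.
by rewrite ler_pM ?cnorm_ge0 ?cabs_ge0 ?cnorm_entry.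
Qed.

Lemma mulmx_bounded J :
  exists2 B : R, 0 <= B & forall v, cnorm (v *m J) <= B * cnorm v.
Proof.
pose b := \sum_i cnorm (row i J); exists (n%:R * b).
  by rewrite mulr_ge0// sumr_ge0// => i _; exact: cnorm_ge0.
move=> v; rewrite -mulrA; apply: cnorm_mulmx_rows => i.
rewrite /b (bigD1 i)//= lerDl sumr_ge0// => j _; exact: cnorm_ge0.
Qed.

(** Differentiability with real valued norms; the differential of [F] at [z] is
    [v |-> v *m J]. *)
Definition cderiv F z J :=
  small (@cnorm R n) (fun h => F (z + h) - F z - h *m J).

Lemma complex_pos (e : R[i]) : 0 < e -> exists2 e' : R, 0 < e' & e = e'%:C.
Proof.
case: e => a b; rewrite ltcE /= => /andP[/eqP -> a0]; by exists a.
Qed.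

Lemma cderiv_near F z J : cderiv F z J <->
  forall e : R[i], 0 < e -> \forall h \near (0 : 'rV[R[i]]_n),
    `|F (z + h) - F z - h *m J| <= e * `|h|.
Proof.
split=> [FJ e /complex_pos [e' e'0 ->]|FJ e e0].
  have [d d0 dP] := FJ e' e'0; apply/nbhs_ballP; exists d%:C => /=.
    by rewrite ltcR.
  move=> h; rewrite -ball_normE /= sub0r normrN !cnormE -rmorphM /= ltcR lecR.
  exact: dP.
have eC : 0 < e%:C by rewrite ltcR.
have /nbhs_ballP[_ /= /complex_pos[d d0 ->] dP] := FJ _ eC.
exists d => // h hd; have := dP h; rewrite -ball_normE /= sub0r normrN.
by rewrite !cnormE -rmorphM /= ltcR lecR; exact.
Qed.

Lemma differentiable_cderiv F z : differentiable F z -> cderiv F z (jac F z).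
Proof.
move=> /diff_locally /eqaddoP FJ; apply/cderiv_near => e e0.
have := FJ e e0; apply: filterS => h; rewrite jac.unlock /jacobian mul_rV_lin1.
by rewrite !fctE opprD addrA (addrC z).
Qed.

Lemma cderiv_differentiable F z J : cderiv F z J ->
  differentiable F z /\ jac F z = J.
Proof.
move=> FJ; have [B B0 BP] := mulmx_bounded J.
have cJ : continuous (mulmxr J : 'rV_n -> 'rV_m).
  apply/bounded_linear_continuous/linear_boundedP.
  exists B%:C; split=> [|r Br x]; first by rewrite realE ler0c B0.
  rewrite (le_trans (_ : _ <= B%:C * `|x|))//.
    by rewrite !cnormE -rmorphM /= lecR.
  by rewrite ler_wpM2r// ltW.
have dJ : 'd F z = mulmxr J :> ('rV_n -> 'rV_m).
  apply: diff_unique => //; apply/eqaddoP => e e0.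
  have /cderiv_near/(_ e e0) := FJ.
  by apply: filterS => h; rewrite !fctE opprD addrA (addrC z).
split.
  apply/diff_locallyP; rewrite dJ; split=> //; apply/eqaddoP => e e0.
  have /cderiv_near/(_ e e0) := FJ.
  by apply: filterS => h; rewrite !fctE opprD addrA (addrC z).
apply/row_matrixP => i; rewrite !rowE jac.unlock /jacobian mul_rV_lin1.
by rewrite dJ.
Qed.

Lemma cderivE F z J : cderiv F z J -> jac F z = J.
Proof. by case/cderiv_differentiable. Qed.

Lemma cderiv_cst (c : 'rV[R[i]]_m) z : cderiv (fun=> c) z 0.
Proof.
move=> e e0; exists 1 => // h _; rewrite subrr mulmx0 subrr cnorm0.
by rewrite mulr_ge0 ?cnorm_ge0// ltW.
Qed.

Lemma cderiv_lin z J : cderiv (fun x => x *m J) z J.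
Proof.
move=> e e0; exists 1 => // h _; rewrite -!mulmxBl (addrC z) addrK subrr mul0mx.
by rewrite cnorm0 mulr_ge0 ?cnorm_ge0// ltW.
Qed.

Lemma cderivD F G z J J' : cderiv F z J -> cderiv G z J' ->
  cderiv (fun x => F x + G x) z (J + J').
Proof.
move=> dF dG; apply: eq_small (smallD dF dG) => h /=.
by rewrite mulmxDr; coordinates; ring.
Qed.

Lemma cderivZ (c : R[i]) F z J : cderiv F z J ->
  cderiv (fun x => c *: F x) z (c *: J).
Proof.
move=> dF; apply: eq_small (smallZ (@cnorm_ge0 R n) c dF) => h /=.
by rewrite -scalemxAr; coordinates; ring.
Qed.

Lemma cderivB F G z J J' : cderiv F z J -> cderiv G z J' ->
  cderiv (fun x => F x - G x) z (J - J').
Proof.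
move=> dF dG; have := cderivD dF (cderivZ (-1) dG).
by rewrite scaleN1r; under [fun x => _]eq_fun do rewrite scaleN1r.
Qed.

Lemma cderiv_shift F z (a : 'rV[R[i]]_n) J : cderiv F (z + a) J ->
  cderiv (fun x => F (x + a)) z J.
Proof. by apply: eq_small => h /=; rewrite (addrAC z). Qed.

Lemma cderiv_line F z v J (c : R[i]) : cderiv F (z + c *: v) J ->
  cdiff (fun k => F (z + k *: v)) c (v *m J).
Proof.
move=> dF e e0; have nv := cnorm_ge0 v.
have [|d d0 dP] := dF (e / (cnorm v + 1)); first by rewrite divr_gt0//; lra.
exists (d / (cnorm v + 1)) => [|k]; first by rewrite divr_gt0//; lra.
rewrite ltr_pdivlMr ?ltr_wpDl// => kd.
have kv : cnorm (k *: v) <= (cnorm v + 1) * cabs k.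
  by rewrite cnormZ mulrC ler_wpM2r ?cabs_ge0// lerDl.
have := dP (k *: v); rewrite (mulrC (cabs k)) in kd.
move=> /(_ (le_lt_trans kv kd)) h.
rewrite scalerDl addrA scalemxAl (le_trans h)//.
rewrite (le_trans (ler_wpM2l _ kv))//; first by rewrite divr_ge0 ?ltW ?ltr_wpDl.
by rewrite mulrA divfK// gt_eqF// ltr_wpDl.
Qed.

End CDeriv.

Section CDerivComp.
Context {R : realType} {n m p : nat}.

Lemma cderiv_comp (F : 'rV[R[i]]_n -> 'rV[R[i]]_m)
    (G : 'rV[R[i]]_m -> 'rV[R[i]]_p) z J J' :
  cderiv F z J -> cderiv G (F z) J' -> cderiv (G \o F) z (J *m J').
Proof.
move=> /cderiv_differentiable[dF <-] /cderiv_differentiable[dG <-].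
have dGF : differentiable (G \o F) z by exact: differentiable_comp.
have := differentiable_cderiv dGF; congr cderiv.
apply/row_matrixP => i; rewrite !rowE mulmxA jac.unlock /jacobian !mul_rV_lin1.
by rewrite diff_comp.
Qed.

End CDerivComp.

(** * Estimates for holomorphic maps *)

Section Estimates.
Context {R : realType} {n m : nat}.
Implicit Types (z w h v : 'rV[R[i]]_n) (F G : 'rV[R[i]]_n -> 'rV[R[i]]_m).
Implicit Types (J : 'M[R[i]]_(n, m)).

(** Cauchy's estimate on the complex line through [z] in the direction [v]. *)
Lemma cauchy_ball F z (d M : R) J v : 0 < d ->
  (forall h, cnorm h <= d -> differentiable F (z + h)) ->
  (forall h, cnorm h <= d -> cnorm (F (z + h)) <= M) ->
  cderiv F z J -> cnorm (v *m J) <= M / d * cnorm v.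
Proof.
move=> d0 Fd FM FJ; have [->|v0] := eqVneq v 0.
  by rewrite mul0mx !cnorm0 mulr0.
have nv : 0 < cnorm v by rewrite lt_def cnorm_eq0 v0 cnorm_ge0.
have in_ball (k : R[i]) : cabs k <= d / cnorm v -> cnorm (k *: v) <= d.
  by rewrite cnormZ ler_pdivlMr.
have := @cauchy_estimate1 R m (fun k => F (z + k *: v)) (v *m J)
  (d / cnorm v) M.
rewrite invf_div mulrA mulrAC; apply.
- exact: divr_gt0.
- move=> k kd; exists (v *m jac F (z + k *: v)).
  by apply/cderiv_line/differentiable_cderiv/Fd/in_ball.
- by move=> k kd; apply/FM/in_ball.
- by apply: cderiv_line; rewrite scale0r addr0.
Qed.

(** The mean value inequality: the bound [(L + e) * h] for the increment over
    an interval of length [h] is additive under bisection and holds locally. *)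
Lemma mean_value_segment F z v (L : R) :
  (forall s : R, 0 <= s <= 1 -> exists2 J, cderiv F (z + s%:C *: v) J &
    cnorm (v *m J) <= L) ->
  cnorm (F (z + v) - F z) <= L.
Proof.
move=> FJ; apply/ler_addgt0Pr => e e0; pose f (s : R) := F (z + s%:C *: v).
pose P (x h : R) : Prop := cnorm (f (x + h) - f x) <= (L + e) * h.
suff : P 0 1 by rewrite /P /f add0r scale1r scale0r addr0 mulr1.
apply: interval_bisection; rewrite /P.
  move=> x h h0 h1 h2; have -> : x + h = x + h / 2 + h / 2 by field.
  have -> : (L + e) * h = (L + e) * (h / 2) + (L + e) * (h / 2) by field.
  exact: le_trans (cnorm_tri (f (x + h / 2)) _ _) (lerD h2 h1).
move=> s s01; have [J dJ JL] := FJ s s01.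
have [d d0 dP] := cderiv_line dJ e0.
exists d => // x h /andP[h0 hd] x0 x1 /andP[xs sx].
have inc (t : R) : `|t| < d ->
    cnorm (f (s + t) - f s - t%:C *: (v *m J)) <= e * `|t|.
  by move=> td; have := dP t%:C; rewrite cabs_real -rmorphD; exact.
have := inc (x + h - s); rewrite subrKC ger0_norm ?subr_ge0// => i1.
have lt1 : x + h - s < d by clear -hd xs; lra.
have {lt1} i1 := i1 lt1.
have := inc (x - s); rewrite subrKC ler0_norm ?subr_le0// opprB => i2.
have lt2 : s - x < d by clear -hd sx; lra.
have {lt2} i2 := i2 lt2.
have -> : f (x + h) - f x = (f (x + h) - f s - (x + h - s)%:C *: (v *m J)) -
    (f x - f s - (x - s)%:C *: (v *m J)) + h%:C *: (v *m J).
  have -> : (x + h - s)%:C = (x - s)%:C + h%:C by rewrite -rmorphD addrAC.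
  move: (f (x + h)) (f s) (f x) (v *m J) => fxh fs fx A; clear.
  by coordinates; ring.
rewrite (le_trans (cnormD_le (cnormB_le i1 i2) (_ : _ <= h * L)))//.
  by rewrite cnormZ cabs_real ger0_norm ?(ltW h0)// ler_wpM2l// ltW.
by clear; lra.
Qed.

Definition holo r F := forall z, strip r z -> differentiable F z.

Lemma holo_cderiv r F z : holo r F -> strip r z -> cderiv F z (jac F z).
Proof. by move=> hF zr; exact/differentiable_cderiv/hF. Qed.

Lemma strip_le r r' z : r' <= r -> strip r' z -> strip r z.
Proof. by rewrite /strip /= => rr /lt_le_trans; exact. Qed.

Lemma strip_add r d z h : strip r z -> cnorm h <= d -> strip (r + d) (z + h).
Proof.
rewrite /strip /= imvecD => zr hd; rewrite (le_lt_trans (ler_normD _ _))//.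
by rewrite ltr_leD// (le_trans (cnorm_imvec _)).
Qed.

Lemma strip_segment r z v (s : R) : strip r z -> strip r (z + v) ->
  0 <= s <= 1 -> strip r (z + s%:C *: v).
Proof.
rewrite /strip /= => zr wr /andP[s0 s1].
have -> : z + s%:C *: v = (1 - s)%:C *: z + s%:C *: (z + v).
  by rewrite rmorphB; coordinates; ring.
rewrite imvecD !imvecZ (le_lt_trans (ler_normD _ _))// !normrZ.
rewrite !ger0_norm ?subr_ge0//.
pose t := Num.max `|imvec z| `|imvec (z + v)|.
have tr : t < r by rewrite gt_max zr.
have h1 : (1 - s) * `|imvec z| <= (1 - s) * t.
  by rewrite ler_wpM2l ?subr_ge0// le_max lexx.
have h2 : s * `|imvec (z + v)| <= s * t by rewrite ler_wpM2l// le_max lexx orbT.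
by rewrite (le_lt_trans (lerD h1 h2))// -mulrDl subrK mul1r.
Qed.

Lemma holo_le r r' F : r' <= r -> holo r F -> holo r' F.
Proof. by move=> rr hF z zr; apply: hF; exact: strip_le zr. Qed.

Section Bounded.
Variables (r' r d M : R) (F : 'rV[R[i]]_n -> 'rV[R[i]]_m).
Hypotheses (d0 : 0 < d) (hF : holo r F).
Hypothesis FM : forall z, strip r z -> cnorm (F z) <= M.

Lemma cauchy_strip z v : r' + d <= r -> strip r' z ->
  cnorm (v *m jac F z) <= M / d * cnorm v.
Proof.
move=> rd zr; have in_strip h : cnorm h <= d -> strip r (z + h).
  by move=> hd; apply: strip_le rd _; exact: strip_add.
apply: (@cauchy_ball F z d M _ v d0) => [h /in_strip zh|h /in_strip zh|].
- exact: hF.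
- exact: FM.
- apply: holo_cderiv hF _; apply: strip_le zr; rewrite (le_trans _ rd)//.
  by rewrite lerDl ltW.
Qed.

Lemma holo_lip z v : r' + d <= r -> strip r' z -> strip r' (z + v) ->
  cnorm (F (z + v) - F z) <= M / d * cnorm v.
Proof.
move=> rd zr zvr; apply: mean_value_segment => s s01.
have zs := strip_segment zr zvr s01; exists (jac F (z + s%:C *: v)).
  apply: holo_cderiv hF _; apply: strip_le zs; rewrite (le_trans _ rd)//.
  by rewrite lerDl ltW.
exact: cauchy_strip.
Qed.

(** The differential at [z + h] minus that at [z] is the differential of
    [F (. + h) - F], which is small by the Lipschitz estimate. *)
Lemma jacobian_lip z h v : r' + d + d <= r -> strip r' z -> strip r' (z + h) ->
  cnorm (v *m jac F (z + h) - v *m jac F z) <= M / d / d * cnorm h * cnorm v.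
Proof.
move=> rd zr zhr; rewrite -mulmxBr.
have sd (x u : 'rV[R[i]]_n) : strip r' x -> cnorm u <= d -> strip (r' + d) (x + u).
  by move=> xr; exact: strip_add.
have sr (x : 'rV[R[i]]_n) : strip (r' + d) x -> strip r x.
  by apply: strip_le; rewrite (le_trans _ rd)// lerDl ltW.
have s0 (x : 'rV[R[i]]_n) : strip r' x -> strip r x.
  by move=> xr; rewrite -(addr0 x); apply/sr/sd; rewrite ?cnorm0// ltW.
rewrite [X in X * cnorm v](_ : _ = M / d * cnorm h / d); last by rewrite mulrAC.
pose G (u : 'rV[R[i]]_n) : 'rV[R[i]]_m := F (u + (z + h)) - F (u + z).
apply: (@cauchy_ball G 0 d (M / d * cnorm h) _ v d0).
- move=> u ud; rewrite add0r; apply: (proj1 (cderiv_differentiable _)).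
  apply: cderivB; apply/cderiv_shift; apply: holo_cderiv hF _.
    by rewrite addrC; apply/sr/sd.
  by rewrite addrC; apply/sr/sd.
- move=> u ud; rewrite add0r /G addrA.
  have zu := sd _ _ zr ud; have zhu := sd _ _ zhr ud.
  rewrite [z + u]addrC in zu; rewrite [z + h + u]addrC addrA in zhu.
  apply: mean_value_segment => s s01.
  have zs := strip_segment zu zhu s01; exists (jac F (u + z + s%:C *: h)).
    exact: holo_cderiv (sr _ zs).
  have := @cauchy_ball F (u + z + s%:C *: h) d M (jac F (u + z + s%:C *: h)) h d0.
  apply=> [y yd|y yd|].
  + by apply: hF; apply: strip_le rd _; exact: strip_add.
  + by apply: FM; apply: strip_le rd _; exact: strip_add.
  + exact: holo_cderiv (sr _ zs).
- by apply: cderivB; apply/cderiv_shift; rewrite add0r; apply: holo_cderiv hF _;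
    exact: s0.
Qed.

(** The map [x |-> F x - x *m jac F z] has a small differential near [z]. *)
Lemma holo_taylor z h : r' + d + d <= r -> strip r' z -> strip r' (z + h) ->
  cnorm (F (z + h) - F z - h *m jac F z) <= M / d / d * cnorm h ^+ 2.
Proof.
move=> rd zr zhr; pose G x := F x - x *m jac F z.
have -> : F (z + h) - F z - h *m jac F z = G (z + h) - G z.
  by rewrite /G mulmxDl; coordinates; ring.
apply: mean_value_segment => s s01; have zs := strip_segment zr zhr s01.
have sr (x : 'rV[R[i]]_n) : strip r' x -> strip r x.
  by apply: strip_le; move: d0 rd; lra.
exists (jac F (z + s%:C *: h) - jac F z).
  apply: cderivB; first exact: holo_cderiv (sr _ zs).
  exact: cderiv_lin.
rewrite mulmxBr (le_trans (jacobian_lip _ rd zr zs))// expr2 mulrA.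
rewrite ler_wpM2r ?cnorm_ge0// cnormZ cabs_real mulrCA.
case/andP: s01 => s0 s1; rewrite ger0_norm// ler_piMl// mulr_ge0 ?cnorm_ge0//.
have M0 := le_trans (cnorm_ge0 _) (FM (sr _ zr)).
by rewrite !mulr_ge0 ?invr_ge0// ltW.
Qed.

End Bounded.

End Estimates.

(** * Limits, derivatives and products of holomorphic maps *)

Section Weierstrass.
Context {R : realType} {n m : nat}.
Implicit Types (z w h v : 'rV[R[i]]_n) (F G : 'rV[R[i]]_n -> 'rV[R[i]]_m).

Lemma strip_room (r : R) z : strip r z -> exists r' d : R,
  [/\ 0 < d, strip r' z & r' + d + d + d <= r].
Proof.
rewrite /strip /= => zr; exists (`|imvec z| + (r - `|imvec z|) / 4).
by exists ((r - `|imvec z|) / 4); split; lra.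
Qed.

Lemma holoB (r : R) F G : holo r F -> holo r G -> holo r (fun x => F x - G x).
Proof.
move=> hF hG z zr.
exact: (cderiv_differentiable (cderivB (holo_cderiv hF zr) (holo_cderiv hG zr))).1.
Qed.

Lemma cnorm_delta (i : 'I_n) : cnorm (delta_mx 0 i : 'rV[R[i]]_n) <= 1.
Proof.
apply/cnormP; split=> // j; rewrite mxE eqxx /=; case: eqP => _ /=.
  by rewrite cabs1.
by rewrite cabs0 ler01.
Qed.

(** Cauchy's estimate, applied to the differences [Fk l - Fk k], shows that
    the differentials converge and that the difference quotients of the [Fk]
    converge uniformly. *)
Lemma holo_limit (r c : R) (Fk : nat -> 'rV[R[i]]_n -> 'rV[R[i]]_m) F z :
  (forall k, holo r (Fk k)) ->
  (forall k w, strip r w -> cnorm (Fk k w - F w) <= c * 2 ^- k) ->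
  strip r z ->
  exists J (c' : R), cderiv F z J /\
    forall k v, cnorm (v *m jac (Fk k) z - v *m J) <= c' * 2 ^- k * cnorm v.
Proof.
move=> hFk FkF zr; have [r' [d [d0 zr' rd]]] := strip_room zr.
have rd' : r' + d + d <= r by clear -d0 rd; lra.
have rd'' : r' + d <= r by clear -d0 rd'; lra.
have c0 : 0 <= c.
  by have := le_trans (cnorm_ge0 _) (FkF 0%N z zr); rewrite expr0 invr1 mulr1.
have diffM k l w : (k <= l)%N -> strip r w ->
    cnorm (Fk l w - Fk k w) <= 2 * c * 2 ^- k.
  move=> kl wr; apply: le_trans (cnorm_tri (F w) _ _) _.
  rewrite [X in _ + X]cnormC; apply: le_trans (lerD (FkF l w wr) (FkF k w wr)) _.
  have := ler_wpM2l c0 (exp2V_le (R := R) kl); lra.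
have JB k : jac (fun x => Fk k.+1 x - Fk k x) z = jac (Fk k.+1) z - jac (Fk k) z.
  by apply: cderivE; apply: cderivB; apply: holo_cderiv zr.
have JS k v : cnorm (v *m jac (Fk k.+1) z - v *m jac (Fk k) z) <=
    2 * c * 2 ^- k / d * cnorm v.
  rewrite -mulmxBr -JB; apply: (cauchy_strip d0 _ _ _ rd'' zr').
    exact: holoB.
  by move=> w; apply: diffM.
have ex_lim (i : 'I_n) : exists li : 'rV[R[i]]_m, forall k,
    cnorm (row i (jac (Fk k) z) - li) <= 4 * (2 * c / d) * 2 ^- k.
  apply: (@cauchy_rate R m (fun k => row i (jac (Fk k) z)) (2 * c / d)) => k.
  have := JS k (delta_mx 0 i); rewrite -!rowE => /le_trans; apply.
  rewrite [leRHS](_ : _ = 2 * c * 2 ^- k / d * 1); last by rewrite mulr1 mulrAC.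
  by rewrite ler_wpM2l ?cnorm_delta// !mulr_ge0 ?invr_ge0// ltW// exp2V_gt0.
have [l lP] := choice ex_lim.
pose J := \matrix_i l i; pose c' := n%:R * (4 * (2 * c / d)).
have JJ k v : cnorm (v *m jac (Fk k) z - v *m J) <= c' * 2 ^- k * cnorm v.
  rewrite -mulmxBr /c' -!mulrA; rewrite [X in n%:R * X](_ : _ =
    4 * (2 * c / d) * 2 ^- k * cnorm v); last by rewrite !mulrA.
  apply: cnorm_mulmx_rows => i; rewrite linearB /= rowK; exact: lP.
have c'0 : 0 <= c' by rewrite !mulr_ge0 ?invr_ge0// ltW.
exists J, c'; split=> // e e0.
have [k ke] := exp2V_small (2 * c / d + c') (half_gt0 e0).
have [d1 d10 d1P] := holo_cderiv (hFk k) zr (half_gt0 e0).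
exists (Num.min d1 d) => [|h]; first by rewrite lt_min d10.
rewrite lt_min => /andP[/d1P h1 /ltW hd].
have zh : strip (r' + d) (z + h) by exact: strip_add.
have zrd : strip (r' + d) z by apply: strip_le zr'; rewrite lerDl ltW.
have in_r w : strip (r' + d) w -> strip r w by exact: strip_le.
pose D w := F w - Fk k w.
have hD : cnorm (D (z + h) - D z) <= 2 * c * 2 ^- k / d * cnorm h.
  apply: (@le_exp2V _ _ _ (2 * c)) => j.
  pose E w := Fk (k + j)%N w - Fk k w.
  have hE : cnorm (E (z + h) - E z) <= 2 * c * 2 ^- k / d * cnorm h.
    apply: (holo_lip d0 _ _ rd' zrd zh); first exact: holoB.
    by move=> w; apply: diffM; rewrite leq_addr.
  have -> : D (z + h) - D z = (E (z + h) - E z) -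
      ((Fk (k + j)%N (z + h) - F (z + h)) - (Fk (k + j)%N z - F z)).
    by rewrite /D /E; coordinates; ring.
  have kl : c * 2 ^- (k + j) <= c * 2 ^- j.
    by rewrite ler_wpM2l// exp2V_le// leq_addl.
  apply: le_trans (cnormB_le hE (cnormB_le
    (le_trans (FkF (k + j)%N _ (in_r _ zh)) kl)
    (le_trans (FkF (k + j)%N _ zr) kl))) _.
  by rewrite lerD2l; clear; lra.
have -> : F (z + h) - F z - h *m J = (D (z + h) - D z) +
    (Fk k (z + h) - Fk k z - h *m jac (Fk k) z) +
    (h *m jac (Fk k) z - h *m J).
  by rewrite /D; coordinates; ring.
apply: le_trans (cnormD_le (cnormD_le hD h1) (JJ k h)) _.
have nh := cnorm_ge0 h; have := ler_wpM2r nh ke.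
clear; set x := cnorm h; set y := 2 ^- k; lra.
Qed.

Lemma holo_lim (r c : R) (Fk : nat -> 'rV[R[i]]_n -> 'rV[R[i]]_m) F :
  (forall k, holo r (Fk k)) ->
  (forall k w, strip r w -> cnorm (Fk k w - F w) <= c * 2 ^- k) ->
  holo r F.
Proof.
move=> hFk FkF z zr; have [J [c' [FJ _]]] := holo_limit hFk FkF zr.
exact: (cderiv_differentiable FJ).1.
Qed.

(** The difference quotients of [F] in the direction [v] converge uniformly by
    Taylor's formula. *)
Lemma holo_jacobian (r M : R) F v : holo r F ->
  (forall w, strip r w -> cnorm (F w) <= M) ->
  holo r (fun z => v *m jac F z).
Proof.
move=> hF FM z zr; have [r' [d [d0 zr' rd]]] := strip_room zr.
have nv := cnorm_ge0 v.
pose t0 := d / (cnorm v + 1).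
have t00 : 0 < t0 by rewrite divr_gt0//; lra.
have t0d : t0 * cnorm v <= d.
  rewrite mulrAC -mulrA ler_piMr ?(ltW d0)// ler_pdivrMr; lra.
pose t k := t0 * 2 ^- k.
have tgt0 k : 0 < t k by rewrite mulr_gt0// exp2V_gt0.
have in_r (x : 'rV[R[i]]_n) : strip (r' + d) x -> strip r x.
  by apply: strip_le; move: d0 rd; clear; lra.
have zrd (x : 'rV[R[i]]_n) : strip r' x -> strip (r' + d) x.
  by apply: strip_le; rewrite lerDl ltW.
have xt x k : strip r' x -> strip (r' + d) (x + (t k)%:C *: v).
  move=> xr; apply: strip_add => //; rewrite cnormZ cabs_real gtr0_norm//.
  rewrite (le_trans _ t0d)// ler_wpM2r// ler_piMr ?(ltW t00)//.
  by rewrite invf_le1 ?exprn_gt0 ?exprn_ege1 ?ler1n.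
have := @holo_lim r' (M / d / d * cnorm v ^+ 2 * t0)
  (fun k x => ((t k)^-1)%:C *: (F (x + (t k)%:C *: v) - F x))
  (fun x => v *m jac F x).
apply=> // [k x xr|k x xr].
  apply: (proj1 (cderiv_differentiable _)); apply: cderivZ; apply: cderivB.
    by apply: cderiv_shift; apply: holo_cderiv hF _; apply/in_r/xt.
  by apply: holo_cderiv hF _; apply/in_r/zrd.
have tV : ((t k)^-1)%:C * (t k)%:C = 1 :> R[i].
  by rewrite -rmorphM /= mulVf// gt_eqF.
rewrite -[v *m _]scale1r -tV -scalerA -scalerBr scalemxAl cnormZ cabs_real.
have := holo_taylor d0 hF FM rd (zrd _ xr) (xt _ k xr).
rewrite gtr0_norm ?invr_gt0// => h; rewrite ler_pdivrMl// (le_trans h)//.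
rewrite cnormZ cabs_real gtr0_norm// /t exprMn.
by move: (2 ^- k) (d^-1) => p q; rewrite le_eqVlt; apply/orP; left; apply/eqP; ring.
Qed.

End Weierstrass.

Section Product.
Context {R : realType} {n m p : nat}.
Implicit Types (z w h v : 'rV[R[i]]_n).

Lemma cderiv_scale (F : 'rV[R[i]]_n -> 'rV[R[i]]_m)
    (G : 'rV[R[i]]_n -> 'rV[R[i]]_p) z J J' (j : 'I_m) :
  cderiv F z J -> cderiv G z J' ->
  cderiv (fun x => F x 0 j *: G x) z (col j J *m G z + F z 0 j *: J').
Proof.
move=> dF dG.
have [B B0 BJ] := mulmx_bounded J; have [B' B'0 BJ'] := mulmx_bounded J'.
have := @small_mul R 'rV_n (@cnorm R n) (@cnorm_ge0 R n) p
  (fun h => F (z + h) 0 j) (F z 0 j) (fun h => (h *m J) 0 j)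
  (fun h => G (z + h)) (G z) (fun h => h *m J') B B' B0 B'0.
have k1 h : cabs ((h *m J) 0 j) <= B * cnorm h.
  by rewrite (le_trans (cnorm_entry _ _)).
move=> /(_ k1 BJ'); have k2 : smallC (@cnorm R n)
    (fun h => F (z + h) 0 j - F z 0 j - (h *m J) 0 j).
  move=> e /dF [d d0 dP]; exists d => // h /dP; apply: le_trans.
  have -> : F (z + h) 0 j - F z 0 j - (h *m J) 0 j =
    (F (z + h) - F z - h *m J) 0 j by rewrite !mxE.
  exact: cnorm_entry.
move=> /(_ k2 dG); apply: eq_small => h /=; congr (_ - _).
rewrite mulmxDr mulmxA -scalemxAr; congr (_ + _).
rewrite colE mulmxA -colE; apply/rowP => i.
by rewrite [RHS]mxE big_ord_recl big_ord0 addr0 !mxE.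
Qed.

Lemma holo_mulmx (r : R) (F : 'rV[R[i]]_n -> 'rV[R[i]]_m)
    (A : 'rV[R[i]]_n -> 'M[R[i]]_(m, p)) : holo r F ->
  (forall i, holo r (fun z => row i (A z))) -> holo r (fun z => F z *m A z).
Proof.
move=> hF hA z zr; under [fun x => _]eq_fun do rewrite mulmx_sum_row.
have -> : (fun x => \sum_i F x 0 i *: row i (A x)) =
    \sum_i (fun x => F x 0 i *: row i (A x)).
  by apply/funext => x; rewrite fct_sumE.
apply: differentiable_sum => i.
by have [] := cderiv_differentiable
  (cderiv_scale i (holo_cderiv hF zr) (holo_cderiv (hA i) zr)).
Qed.

End Product.

(** * Real analytic vector fields on the complex torus *)

Notation field := real_analytic_vector_field.

Section Fields.
Context {R : realType} {n : nat}.
Implicit Types (z w h v : 'rV[R[i]]_n) (F G Y : 'rV[R[i]]_n -> 'rV[R[i]]_n).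
Implicit Types (r s d e : R).

Definition bounded r F (M : R) := forall z, strip r z -> cnorm (F z) <= M.

Lemma field_holo r F : field r F -> holo r F.
Proof. by case; case. Qed.

Lemma field_real r F x : field r F -> imvec (F (cvec x)) = 0.
Proof. by case; case. Qed.

Lemma field_periodic r F z k : field r F -> strip r z -> F (z + czvec k) = F z.
Proof. by case=> _; exact. Qed.

Lemma strip_real r x : 0 < r -> strip r (cvec x : 'rV[R[i]]_n).
Proof. by rewrite /strip /= imvec_cvec normr0. Qed.

Lemma strip_translate r z x : strip r (z + cvec x) = strip r z.
Proof. by rewrite /strip /= imvecD imvec_cvec addr0. Qed.

Lemma imvec_scale (c : R) z : imvec z = 0 -> imvec (c%:C *: z) = 0.
Proof. by move=> z0; rewrite imvecZ z0 scaler0. Qed.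

Lemma field_le r r' F : r' <= r -> field r F -> field r' F.
Proof.
move=> rr [[hF rF] pF]; split; first by split=> // z; apply/(holo_le rr).
by move=> z k /(strip_le rr); exact: pF.
Qed.

Lemma fieldD r F G : field r F -> field r G -> field r (fun z => F z + G z).
Proof.
move=> fF fG; split; first split.
- move=> z zr; exact: (cderiv_differentiable (cderivD
    (holo_cderiv (field_holo fF) zr) (holo_cderiv (field_holo fG) zr))).1.
- by move=> x; rewrite imvecD (field_real _ fF) (field_real _ fG) addr0.
- by move=> z k zr; rewrite (field_periodic k fF zr) (field_periodic k fG zr).
Qed.

Lemma fieldZ r F (c : R) : field r F -> field r (fun z => c%:C *: F z).
Proof.
move=> fF; split; first split.
- move=> z zr; exact: (cderiv_differentiable
    (cderivZ c%:C (holo_cderiv (field_holo fF) zr))).1.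
- by move=> x; rewrite imvec_scale// (field_real _ fF).
- by move=> z k zr; rewrite (field_periodic k fF zr).
Qed.

Lemma fieldB r F G : field r F -> field r G -> field r (fun z => F z - G z).
Proof.
move=> fF fG; have := fieldD fF (fieldZ (-1) fG).
by under [fun z => F z + _]eq_fun do rewrite rmorphN rmorph1 scaleN1r.
Qed.

Lemma field_cst r (x : 'rV[R]_n) : field r (constant_field x).
Proof.
split=> //; split; last by move=> y; rewrite imvec_cvec.
by move=> z _; exact: (cderiv_differentiable (cderiv_cst _ _)).1.
Qed.

Lemma field0 r : field r (fun _ : 'rV[R[i]]_n => 0).
Proof.
split=> //; split=> [z _|x]; last exact: imvec0.
exact: (cderiv_differentiable (cderiv_cst 0 z)).1.
Qed.

Lemma field_translate r F x : field r F -> field r (fun z => F (z + cvec x)).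
Proof.
move=> fF; split; first split.
- move=> z zr; refine (cderiv_differentiable (cderiv_shift _)).1.
  by apply: holo_cderiv (field_holo fF) _; rewrite strip_translate.
- by move=> y; rewrite -cvecD (field_real _ fF).
- move=> z k zr; rewrite addrAC (field_periodic k fF)//.
  by rewrite strip_translate.
Qed.

Lemma field_lim r (Fk : nat -> 'rV[R[i]]_n -> 'rV[R[i]]_n) F (c : R) : 0 < r ->
  (forall k, field r (Fk k)) ->
  (forall k z, strip r z -> cnorm (Fk k z - F z) <= c * 2 ^- k) ->
  field r F.
Proof.
move=> r0 fk Fkl; split; first split.
- by apply: holo_lim Fkl => k; exact: field_holo.
- move=> x; apply/eqP; rewrite -normr_le0; apply: (@le_exp2V _ _ _ c) => k.
  rewrite add0r (le_trans _ (Fkl k _ (strip_real x r0)))//.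
  rewrite (le_trans _ (cnorm_imvec _))// imvecB (field_real _ (fk k)) sub0r.
  by rewrite normrN.
- move=> z k zr; apply/eqP; rewrite -subr_eq0 -cnorm_eq0 eq_le cnorm_ge0 andbT.
  apply: (@le_exp2V _ _ _ (2 * c)) => j; rewrite add0r.
  have zkr : strip r (z + czvec k) by rewrite strip_translate.
  have := cnorm_tri (Fk j z) (F (z + czvec k)) (F z).
  have h1 := Fkl j _ zr; have := Fkl j _ zkr.
  rewrite (field_periodic k (fk j) zr) cnormC => h2 /le_trans; apply.
  by apply: le_trans (lerD h2 h1) _; clear; lra.
Qed.

Lemma cderiv_strip r F G z J : strip r z ->
  (forall w, strip r w -> F w = G w) -> cderiv F z J -> cderiv G z J.
Proof.
move=> zr FG dF e /dF [d d0 dP].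
exists (Num.min d (r - `|imvec z|)) => [|h]; first by rewrite lt_min d0 subr_gt0.
rewrite lt_min => /andP[hd hr]; rewrite -!FG//; first exact: dP.
rewrite /strip /= imvecD (le_lt_trans (ler_normD _ _))// addrC -ltrBrDr.
by rewrite (le_lt_trans (cnorm_imvec _)).
Qed.

Lemma jac_periodic r F z k : field r F -> strip r z ->
  jac F (z + czvec k) = jac F z.
Proof.
move=> fF zr; have zkr : strip r (z + czvec k) by rewrite strip_translate.
have := cderiv_shift (holo_cderiv (field_holo fF) zkr).
move=> /(@cderiv_strip r _ F _ _ zr) dF; apply/esym/cderivE/dF.
by move=> w wr; exact: field_periodic wr.
Qed.

(** Difference quotients with real increments at real points are real. *)
Lemma jac_real r F (x y : 'rV[R]_n) : 0 < r -> field r F ->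
  imvec (cvec y *m jac F (cvec x)) = 0.
Proof.
move=> r0 fF; apply/eqP; rewrite -normr_le0; apply/ler_addgt0Pr => e e0.
rewrite add0r; have ny := normr_ge0 y.
have e'0 : 0 < e / (`|y| + 1) by rewrite divr_gt0//; lra.
have [d d0 dP] := holo_cderiv (field_holo fF) (strip_real x r0) e'0.
pose t := d / 2 / (`|y| + 1).
have t0 : 0 < t by rewrite divr_gt0 ?half_gt0//; lra.
have ty : cnorm (t%:C *: cvec y) = t * `|y|.
  by rewrite cnormZ cabs_real gtr0_norm// cnorm_cvec.
have := dP (t%:C *: cvec y); rewrite ty => h.
have {}h := h _; have td : t * `|y| < d.
  rewrite /t mulrAC -mulrA; apply: (@le_lt_trans _ _ (d / 2 * 1)); last first.
    by move: d0; clear; lra.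
  by rewrite ler_wpM2l ?ltW ?half_gt0// ltr_pdivrMr; clear -ny; lra.
have {h} := h td; rewrite -scalemxAl => h.
have := le_trans (cnorm_imvec _) h; rewrite !imvecB -cvecZ -cvecD.
rewrite !(field_real _ fF) subrr sub0r normrN imvecZ normrZ gtr0_norm//.
rewrite mulrCA ler_pM2l// => /le_trans; apply.
by rewrite mulrAC -mulrA ler_piMr ?(ltW e0)// ler_pdivrMr; clear -ny; lra.
Qed.

Lemma field_mul_jac r F Y (M : R) : 0 < r -> field r F -> field r Y ->
  bounded r Y M -> field r (fun z => F z *m jac Y z).
Proof.
move=> r0 fF fY YM; split; first split.
- apply: holo_mulmx (field_holo fF) _ => i.
  have := holo_jacobian (delta_mx 0 i) (field_holo fY) YM.
  by under eq_fun do rewrite -rowE.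
- move=> x; rewrite (imvec_eq0 (field_real x fF)); exact: jac_real r0 fY.
- by move=> z k zr; rewrite (field_periodic k fF zr) (jac_periodic k fY zr).
Qed.

Lemma cderiv_displacement Y z J : cderiv Y z J ->
  cderiv (fun x => x + Y x) z (1%:M + J).
Proof.
move=> dY; apply: (cderivD _ dY); have := cderiv_lin z (1%:M : 'M[R[i]]_n).
by under eq_fun do rewrite mulmx1.
Qed.

Lemma field_comp r r' F U : field r F -> field r' U ->
  (forall z, strip r' z -> strip r (z + U z)) ->
  field r' (fun z => F (z + U z)).
Proof.
move=> fF fU rU; split; first split.
- move=> z zr; exact: (cderiv_differentiable (cderiv_comp
    (cderiv_displacement (holo_cderiv (field_holo fU) zr))
    (holo_cderiv (field_holo fF) (rU z zr)))).1.
- by move=> x; rewrite (imvec_eq0 (field_real x fU)) -cvecD (field_real _ fF).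
- move=> z k zr; rewrite (field_periodic k fU zr) addrAC.
  by rewrite (field_periodic k fF (rU z zr)).
Qed.

Lemma expanding_unitmx (A : 'M[R[i]]_n) (c : R) : 0 < c ->
  (forall v, c * cnorm v <= cnorm (v *m A)) -> A \in unitmx.
Proof.
move=> c0 cA; rewrite -row_free_unit; apply: inj_row_free => v vA.
have := cA v; rewrite vA cnorm0 pmulr_rle0// => v0; apply/eqP.
by rewrite -cnorm_eq0 eq_le v0 cnorm_ge0.
Qed.

Lemma near_identity_expanding (A : 'M[R[i]]_n) (c : R) :
  (forall v, cnorm (v *m A) <= c * cnorm v) ->
  forall v, (1 - c) * cnorm v <= cnorm (v *m (1%:M + A)).
Proof.
move=> Ac v; rewrite mulmxDr mulmx1 mulrBl mul1r lerBlDr.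
have := cnormB (v + v *m A) (v *m A); rewrite addrK => /le_trans; apply.
by rewrite lerD2l.
Qed.

(** The solution [W] of [W + W *m jac Y = B] is the uniform limit of the
    Neumann iterates [W' |-> B - W' *m jac Y] that start at [B]; this is why it
    is again a real analytic vector field. *)
Lemma field_solve r Y B (M b c : R) : 0 < r -> field r Y -> bounded r Y M ->
  field r B -> bounded r B b -> c <= 2^-1 ->
  (forall z v, strip r z -> cnorm (v *m jac Y z) <= c * cnorm v) ->
  exists W, [/\ field r W,
    forall z, strip r z -> W z *m (1%:M + jac Y z) = B z &
    bounded r W (b / (1 - c))].
Proof.
move=> r0 fY YM fB Bb c2 Yc; have c1 : 0 < 1 - c by move: c2; clear; lra.
pose A z := 1%:M + jac Y z; pose W z := B z *m invmx (A z).
have exp_ z : strip r z -> forall v, (1 - c) * cnorm v <= cnorm (v *m A z).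
  by move=> zr; apply: near_identity_expanding => v; exact: Yc.
have WA z : strip r z -> W z *m A z = B z.
  by move=> zr; rewrite /W mulmxKV// (expanding_unitmx c1 (exp_ z zr)).
have Wb : bounded r W (b / (1 - c)).
  move=> z zr; rewrite ler_pdivlMr// mulrC (le_trans (exp_ z zr _))// WA//.
  exact: Bb.
exists W; split=> //.
pose step F := fun z => B z - F z *m jac Y z.
apply: (@field_lim r (fun k => iter k step B) W (b / (1 - c)) r0) => k.
  elim: k => [//|k IH] /=; apply: fieldB => //.
  exact: field_mul_jac r0 IH fY YM.
move=> z zr; elim: k => [|k IH] /=.
  have -> : B z - W z = W z *m jac Y z.
    by rewrite -(WA z zr) /A mulmxDr mulmx1 addrC addKr.
  rewrite expr0 invr1 mulr1 (le_trans (Yc z _ zr))//.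
  apply: le_trans (Wb z zr); rewrite ler_piMl ?cnorm_ge0//.
  by move: c2; clear; lra.
have -> : step (iter k step B) z - W z = - ((iter k step B z - W z) *m jac Y z).
  rewrite /step -(WA z zr) /A mulmxDr mulmx1 mulmxBl.
  by coordinates; ring.
rewrite cnormN (le_trans (Yc z _ zr))//.
apply: le_trans (ler_wpM2r (cnorm_ge0 _) c2) _.
by rewrite exprS invfM mulrCA ler_wpM2l.
Qed.

End Fields.

(** * Averaging along a periodic direction *)

Section Averaging.
Context {R : realType} {n : nat}.
Implicit Types (z h v : 'rV[R[i]]_n) (F G Y S : 'rV[R[i]]_n -> 'rV[R[i]]_n).
Implicit Types (r s d e M : R).

Lemma field_dmean r k (f : R -> 'rV[R[i]]_n -> 'rV[R[i]]_n) :
  (forall u, field r (f u)) -> field r (fun z => dmean k (fun u => f u z)).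
Proof.
elim: k f => [|k IH] f ff /=; first exact: ff.
apply: fieldZ; apply: fieldD.
  exact: (IH (fun u => f (u / 2))).
exact: (IH (fun u => f ((u + 1) / 2))).
Qed.

Lemma cderiv_dmean k (f : R -> 'rV[R[i]]_n -> 'rV[R[i]]_n)
    (J : R -> 'M[R[i]]_n) z : (forall u, cderiv (f u) z (J u)) ->
  exists2 K, cderiv (fun z => dmean k (fun u => f u z)) z K &
    forall v, v *m K = dmean k (fun u => v *m J u).
Proof.
elim: k f J => [|k IH] f J fJ /=; first by exists (J 0).
have [K1 dK1 K1E] := IH (fun u => f (u / 2)) (fun u => J (u / 2)) (fun u => fJ _).
have [K2 dK2 K2E] := IH (fun u => f ((u + 1) / 2)) (fun u => J ((u + 1) / 2))
  (fun u => fJ _).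
exists ((2^-1)%:C *: (K1 + K2)); first by apply: cderivZ; exact: cderivD.
by move=> v; rewrite -scalemxAr mulmxDr K1E K2E.
Qed.

Lemma rate_limit_unique m (u : nat -> 'rV[R[i]]_m) (l l' : 'rV[R[i]]_m) (c c' : R) :
  (forall k, cnorm (u k - l) <= c * 2 ^- k) ->
  (forall k, cnorm (u k - l') <= c' * 2 ^- k) -> l = l'.
Proof.
move=> ul ul'; apply/eqP; rewrite -subr_eq0 -cnorm_eq0 eq_le cnorm_ge0 andbT.
apply: (@le_exp2V _ _ _ (c + c')) => k; rewrite add0r mulrDl.
by rewrite (le_trans (cnorm_tri (u k) _ _))// lerD// cnormC.
Qed.

Lemma rate_limit_bound m (u : nat -> 'rV[R[i]]_m) (l : 'rV[R[i]]_m) (c M : R) :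
  (forall k, cnorm (u k - l) <= c * 2 ^- k) ->
  (forall k, cnorm (u k) <= M) -> cnorm l <= M.
Proof.
move=> ul uM; apply: (@le_exp2V _ _ _ c) => k.
have -> : l = u k - (u k - l) by rewrite opprB addrC subrK.
exact: cnormB_le.
Qed.

Section OneDirection.
Variables (r M : R) (S : 'rV[R[i]]_n -> 'rV[R[i]]_n) (x : 'rV[int]_n).
Hypotheses (r0 : 0 < r) (fS : field r S) (SM : bounded r S M).

Let flow (u : R) z : 'rV[R[i]]_n := z + cvec (u *: zvec x).

Let flow_strip s u z : strip s (flow u z) = strip s z.
Proof. exact: strip_translate. Qed.

Let flowE (u w : R) z : flow w z = flow u z + (w - u)%:C *: czvec x.
Proof. by rewrite /flow /czvec -cvecZ -addrA -cvecD -scalerDl subrKC. Qed.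

Let M0 : 0 <= M.
Proof. exact: le_trans (cnorm_ge0 _) (SM (strip_real 0 r0)). Qed.

Let flow_lip s d (u w : R) z : 0 < d -> s + d <= r -> strip s z ->
  cnorm (S (flow w z) - S (flow u z)) <= M / d * cnorm (czvec x) * `|w - u|.
Proof.
move=> d0 sd zs; rewrite (flowE u w).
rewrite (le_trans (holo_lip d0 (field_holo fS) SM sd _ _))//.
- by rewrite flow_strip.
- by rewrite -flowE flow_strip.
- by rewrite cnormZ cabs_real [_ * cnorm _]mulrC mulrA.
Qed.

(** The weighted means of [S] along the closed orbits of the direction [x]
    converge at the rate [2 ^- k] because [S] is Lipschitz on smaller strips. *)
Lemma weighted_mean (phi : R -> R) :
  (forall u, 0 <= u <= 1 -> `|phi u| <= 1) ->
  (forall u w : R, 0 <= u <= 1 -> 0 <= w <= 1 -> `|phi u - phi w| <= `|u - w|) ->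
  exists W, [/\ field r W, bounded r W M & forall z v, strip r z ->
    exists c : R, forall k,
      cnorm (dmean k (fun u => (phi u)%:C *: S (flow u z)) - W z) <= c * 2 ^- k /\
      cnorm (dmean k (fun u => (phi u)%:C *: (v *m jac S (flow u z))) -
        v *m jac W z) <= c * 2 ^- k].
Proof.
move=> phi1 phiL; pose Wk k z := dmean k (fun u => (phi u)%:C *: S (flow u z)).
have fWk k : field r (Wk k).
  by apply: field_dmean => u; apply/fieldZ/field_translate.
have WkM k z : strip r z -> cnorm (Wk k z) <= M.
  move=> zr; apply: dmean_le => u /andP[u0 /ltW u1].
  rewrite cnormZ cabs_real (le_trans (ler_wpM2r (cnorm_ge0 _) (phi1 u _)))//.
    by rewrite u0.
  by rewrite mul1r SM ?flow_strip.
pose L d : R := M / d * cnorm (czvec x : 'rV[R[i]]_n) + M.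
have WkS s d k z : 0 < d -> s + d <= r -> strip s z ->
    cnorm (Wk k.+1 z - Wk k z) <= L d * 2 ^- k.
  move=> d0 sd zs; apply: dmean_lip => u w u01 w01.
  have -> : (phi u)%:C *: S (flow u z) - (phi w)%:C *: S (flow w z) =
      (phi u)%:C *: (S (flow u z) - S (flow w z)) +
      (phi u - phi w)%:C *: S (flow w z) by rewrite rmorphB; coordinates; ring.
  rewrite /L mulrDl; apply: cnormD_le; rewrite cnormZ cabs_real.
    apply: le_trans (ler_wpM2r (cnorm_ge0 _) (phi1 u u01)) _.
    by rewrite mul1r; exact: flow_lip d0 sd zs.
  rewrite mulrC ler_pM ?cnorm_ge0//; last exact: phiL.
  by apply: SM; rewrite flow_strip; apply: strip_le zs; lra.
have ex_lim z : exists l, strip r z -> exists c : R, forall k,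
    cnorm (Wk k z - l) <= c * 2 ^- k.
  have [zr|zr] := pselect (strip r z); last by exists 0 => /zr.
  have [s [d [d0 zs sd]]] := strip_room zr.
  have [|l lP] := @cauchy_rate R n (fun k => Wk k z) (L d).
    by move=> k; apply: (WkS s) => //; lra.
  by exists l => _; exists (4 * L d).
have [W WP] := choice ex_lim.
have WkW s d k z : 0 < d -> s + d <= r -> strip s z ->
    cnorm (Wk k z - W z) <= 4 * L d * 2 ^- k.
  move=> d0 sd zs.
  have [l lP] := @cauchy_rate R n (fun k => Wk k z) (L d)
    (fun k => WkS s d k z d0 sd zs).
  have [|c cP] := WP z; first by apply: strip_le zs; lra.
  by rewrite (rate_limit_unique cP lP).
have fWs s d : 0 < s -> 0 < d -> s + d <= r -> field s W.
  move=> s0 d0 sd; apply: (@field_lim _ _ s Wk W (4 * L d) s0) => [k|k z zs].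
    by apply: field_le (fWk k); lra.
  exact: WkW zs.
have fW : field r W.
  split; first split.
  - move=> z zr; have [s [d [d0 zs sd]]] := strip_room zr.
    have s0 : 0 < s by exact: le_lt_trans (normr_ge0 _) zs.
    by apply: (field_holo (fWs s d s0 d0 _)) => //; lra.
  - by move=> y; apply: (field_real y (fWs (r / 2) (r / 2) _ _ _));
      rewrite ?half_gt0// -splitr.
  - move=> z k zr; have [s [d [d0 zs sd]]] := strip_room zr.
    have s0 : 0 < s by exact: le_lt_trans (normr_ge0 _) zs.
    by apply: (field_periodic k (fWs s d s0 d0 _)) => //; lra.
exists W; split=> //.
  by move=> z zr; have [c cP] := WP z zr; apply: rate_limit_bound cP _ => k;
    exact: WkM.
move=> z v zr; have [s [d [d0 zs sd]]] := strip_room zr.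
have sd' : s + d <= r by lra.
have sr : s <= r by lra.
have [J [c [dJ cP]]] := @holo_limit R n n s (4 * L d) Wk W z
  (fun k => field_holo (field_le sr (fWk k)))
  (fun k w ws => WkW s d k w d0 sd' ws) zs.
exists (Num.max (4 * L d) (c * cnorm v)) => k; split.
  rewrite (le_trans (WkW s d k z d0 sd' zs))//.
  by rewrite ler_wpM2r ?(ltW (exp2V_gt0 _))// le_max lexx.
have [u|K dK KE] := @cderiv_dmean k (fun u z => (phi u)%:C *: S (flow u z))
    (fun u => (phi u)%:C *: jac S (flow u z)) z.
  apply: cderivZ; apply: cderiv_shift; apply: holo_cderiv (field_holo fS) _.
  by rewrite strip_translate.
have := cP k v; rewrite (cderivE dJ) (cderivE dK) KE.
rewrite (_ : dmean k _ = dmean k (fun u => (phi u)%:C *: (v *m jac S (flow u z)))).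
  move/le_trans; apply; rewrite mulrAC.
  by rewrite ler_wpM2r ?(ltW (exp2V_gt0 _))// le_max lexx orbT.
by apply: dmean_eq => u _; rewrite -scalemxAr.
Qed.

(** The fundamental theorem of calculus on the unit interval, [S] being periodic:
    for [u |-> S (z + u *: x)] it says that the mean [A] is invariant along [x],
    for [u |-> u *: S (z + u *: x)] that the first moment [G] solves the
    homological equation. *)
Lemma averaging : exists A G, [/\ field r A, field r G, bounded r A M,
    bounded r G M &
  (forall z, strip r z ->
    [/\ czvec x *m jac A z = 0, czvec x *m jac G z = S z - A z &
      forall v, (forall h, strip r h -> v *m jac S h = 0) -> v *m jac A z = 0])].
Proof.
have [A [fA AM AP]] := @weighted_mean (fun=> 1)
  (fun u _ => ltac:(by rewrite normr1))
  (fun u w _ _ => ltac:(by rewrite subrr normr0)).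
have [G [fG GM GP]] := @weighted_mean id
  (fun u u01 => ltac:(by case/andP: u01 => u0 u1; rewrite ger0_norm))
  (fun u w _ _ => lexx _).
exists A, G; split=> // z zr; pose X : 'rV[R[i]]_n := czvec x.
have [s [d [d0 zs sd]]] := strip_room zr.
have sd' : s + d <= r by lra.
have sd'' : s + d + d <= r by lra.
pose f u := S (flow u z); pose g u := X *m jac S (flow u z).
pose L := M / d / d * cnorm X ^+ 2.
have fg u w : cnorm (f w - f u - (w - u)%:C *: g u) <= L * (w - u) ^+ 2.
  rewrite /f /g (flowE u w) scalemxAl.
  have := holo_taylor d0 (field_holo fS) SM sd'' (z := flow u z)
    (h := (w - u)%:C *: X); rewrite -flowE !flow_strip => /(_ zs zs)/le_trans; apply.
  by rewrite cnormZ cabs_real exprMn real_normK ?num_real//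
    [_ * cnorm _ ^+ 2]mulrC mulrA.
have gM u : cnorm (g u) <= M / d * cnorm X.
  by apply: (cauchy_strip d0 (field_holo fS) SM X sd'); rewrite flow_strip.
have f0 : f 0 = S z by rewrite /f /flow scale0r (_ : cvec 0 = 0) ?addr0//;
  apply/rowP => j; rewrite !mxE.
have f1 : f 1 = S z.
  by rewrite /f /flow scale1r -/(czvec x) (field_periodic x fS zr).
split.
- have [c cP] := AP z X zr.
  apply: (@rate_limit_unique n (fun k => dmean k g) _ 0 c L) => k.
    have [_] := cP k; rewrite (_ : dmean k _ = dmean k g)//.
    by apply: dmean_eq => u _; rewrite scale1r.
  have := @dmean_ftc R n k f g L (fun u w _ _ => fg u w).
  by rewrite f1 f0 subrr.
- have [c cP] := AP z X zr; have [c' cP'] := GP z X zr.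
  pose g2 u := f u + u%:C *: g u.
  suff e : S z = A z + X *m jac G z by rewrite {1}e addrC addKr.
  apply: (@rate_limit_unique n (fun k => dmean k g2) _ _ (L + M / d * cnorm X)
    (c + c')) => k.
    have := @dmean_ftc R n k (fun u => u%:C *: f u) g2 (L + M / d * cnorm X).
    rewrite scale1r scale0r subr0 f1; apply=> u w u01 w01.
    have -> : w%:C *: f w - u%:C *: f u - (w - u)%:C *: g2 u =
      w%:C *: (f w - f u - (w - u)%:C *: g u) +
      ((w - u) ^+ 2)%:C *: g u.
      by rewrite /g2 rmorphXn rmorphB /=; coordinates; ring.
    rewrite mulrDl; apply: cnormD_le; rewrite cnormZ cabs_real.
      apply: le_trans (fg u w); case/andP: w01 => w0 w1.
      by rewrite ler_piMl ?cnorm_ge0// ger0_norm.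
    by rewrite ger0_norm ?sqr_ge0// mulrC ler_wpM2r ?sqr_ge0.
  have [cA _] := cP k; have [_ cG] := cP' k.
  rewrite /g2 dmeanD opprD addrACA mulrDl; apply: cnormD_le => //.
  move: cA; rewrite (_ : dmean k _ = dmean k f)//.
  by apply: dmean_eq => u _; rewrite scale1r.
- move=> v vS; have [c cP] := AP z v zr.
  apply: (@rate_limit_unique n (fun=> 0) _ 0 c 0) => k; last first.
    by rewrite subrr cnorm0 mul0r.
  have [_] := cP k; rewrite (_ : dmean k _ = 0)//.
  rewrite -[RHS](dmean_cst k); apply: dmean_eq => u _.
  by rewrite vS ?flow_strip// scaler0.
Qed.

End OneDirection.
End Averaging.

(** * Conjugations and one step of averaging *)

Section Conjugation.
Context {R : realType} {n : nat}.
Implicit Types (z w v : 'rV[R[i]]_n) (U V W N S P : 'rV[R[i]]_n -> 'rV[R[i]]_n).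
Implicit Types (r s e : R) (alpha : 'rV[R]_n).

(** A change of variables [z + U z] that conjugates [V] to [V'], given by its
    periodic displacement.  The bound from below on the distances of its values
    makes it an embedding, and passes to compositions. *)
Record conjugates r r' e V V' U : Prop := Conjugates {
  conj_field : field r' U;
  conj_close : bounded r' U e;
  conj_range : forall z, strip r' z -> strip r (z + U z);
  conj_expanding : exists2 c : R, 0 < c & forall z w, strip r' z -> strip r' w ->
    c * cnorm (z - w) <= cnorm (z + U z - (w + U w));
  conj_immersion : forall z, strip r' z -> 1%:M + jac U z \in unitmx;
  conj_equation : forall z, strip r' z ->
    V' z *m (1%:M + jac U z) = V (z + U z) }.

Lemma conjugates_id r V : conjugates r r 0 V V (fun=> 0).
Proof.
split.
- exact: field0.
- by move=> z _; rewrite cnorm0.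
- by move=> z; rewrite addr0.
- by exists 1 => // z w _ _; rewrite !addr0 mul1r.
- by move=> z _; rewrite (cderivE (cderiv_cst _ _)) addr0 unitmx1.
- by move=> z _; rewrite addr0 (cderivE (cderiv_cst _ _)) addr0 mulmx1.
Qed.

Lemma conjugates_trans r0 r1 r2 e1 e2 V0 V1 V2 U1 U2 :
  conjugates r0 r1 e1 V0 V1 U1 -> conjugates r1 r2 e2 V1 V2 U2 ->
  conjugates r0 r2 (e1 + e2) V0 V2 (fun z => U1 (z + U2 z) + U2 z).
Proof.
move=> [fU1 U1e rU1 [c1 c10 U1c] U1u U1V] [fU2 U2e rU2 [c2 c20 U2c] U2u U2V].
have UE z : z + (U1 (z + U2 z) + U2 z) = z + U2 z + U1 (z + U2 z).
  by rewrite addrA addrAC.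
have JE z : strip r2 z -> 1%:M + jac (fun z => U1 (z + U2 z) + U2 z) z =
    (1%:M + jac U2 z) *m (1%:M + jac U1 (z + U2 z)).
  move=> zr; have d2 := holo_cderiv (field_holo fU2) zr.
  have d1 := holo_cderiv (field_holo fU1) (rU2 _ zr).
  have := cderivD (cderiv_comp (cderiv_displacement d2) d1) d2.
  by move=> /cderivE ->; rewrite mulmxDr mulmx1 addrA addrAC -addrA addrC.
split.
- by apply: fieldD => //; exact: field_comp fU1 fU2 rU2.
- by move=> z zr; apply: cnormD_le; [apply/U1e/rU2|exact: U2e].
- by move=> z zr; rewrite UE; apply/rU1/rU2.
- exists (c1 * c2) => [|z w zr wr]; first exact: mulr_gt0.
  rewrite !UE -mulrA; apply: le_trans (U1c _ _ (rU2 _ zr) (rU2 _ wr)).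
  by rewrite ler_wpM2l ?(ltW c10)// U2c.
- by move=> z zr; rewrite JE// unitmx_mul U2u ?U1u//; exact: rU2.
- move=> z zr; rewrite JE// UE -U1V; last exact: rU2.
  by rewrite -U2V// -mulmxA.
Qed.

Lemma conjugates_eq r r' e e' V0 V1 V0' V1' U : e <= e' ->
  V0 =1 V0' -> V1 =1 V1' ->
  conjugates r r' e V0 V1 U -> conjugates r r' e' V0' V1' U.
Proof.
move=> ee /funext <- /funext <- [fU Ue rU Uc Uu UV]; split=> // z zr.
exact: le_trans (Ue z zr) ee.
Qed.

(** With [A] the mean and [G] the first moment of [S] along [x], the displacement
    is [t *: G]: it solves the homological equation for the constant field
    [t^-1 *: zvec x], which replaces [alpha] up to an error [b / `|t|].  The field
    [B] in the proof collects what is not averaged: up to [W], products of [U]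
    or [b] with derivatives of the given fields.  The factor [j] in the bound on
    [W] counts the steps that precede this one. *)
Lemma averaging_step r delta (b eps rho t : R) (d j : nat) alpha
    (x : 'rV[int]_n) N S W :
  0 < delta -> 0 < r - delta -> 0 < eps -> 0 <= rho <= eps -> (j < d)%N ->
  `|t| * eps <= b / 2 -> `|t *: alpha - zvec x| <= b ->
  32 * d%:R * b <= delta ->
  field r N -> field r S -> field r W ->
  bounded r N (2 * eps) -> bounded r S rho ->
  bounded r W (rho * (j%:R / (2 * d%:R))) ->
  exists U S' W', [/\
    conjugates r (r - delta) (b / 2 * (rho / eps))
      (fun z => cvec alpha + N z + S z + W z)
      (fun z => cvec alpha + N z + S' z + W' z) U,
    field (r - delta) S' /\ field (r - delta) W',
    bounded (r - delta) S' rho,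
    bounded (r - delta) W' (rho * (j.+1%:R / (2 * d%:R))) &
    forall z, strip (r - delta) z -> czvec x *m jac S' z = 0 /\
      forall v, (forall w, strip r w -> v *m jac S w = 0) -> v *m jac S' z = 0].
Proof.
move=> de0 rd0 eps0 /andP[rho0 rhoe] jd te talpha dbd fN fS fW NM SM WM.
set r' := r - delta.
have r0 : 0 < r by lra.
have r'r : r' <= r by rewrite /r'; lra.
have r'd : r' + delta <= r by rewrite /r' subrK.
have d1 : 1 <= d%:R :> R by rewrite ler1n (leq_ltn_trans _ jd).
have b0 : 0 <= b by exact: le_trans (normr_ge0 _) talpha.
have bd : 32 * b <= delta.
  by apply: le_trans dbd; rewrite ler_wpM2r// ler_peMr.
have [A [G [fA fG AM GM AGP]]] := averaging x r0 fS SM.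
pose U z := t%:C *: G z.
have fU : field r U by exact: fieldZ.
pose u := `|t| * rho.
have uE : u <= b / 2 * (rho / eps).
  rewrite /u mulrA ler_pdivlMr// mulrAC ler_wpM2r//.
have ub : u <= b / 2.
  by apply: le_trans te; rewrite /u ler_wpM2l.
have u0 : 0 <= u by rewrite mulr_ge0.
have UM : bounded r U u.
  by move=> z zr; rewrite cnormZ cabs_real ler_wpM2l// GM.
have Ud : u <= delta / 2 by move: ub bd; clear -b0; lra.
have rU2 z : strip r' z -> strip (r - delta / 2) (z + U z).
  move=> zr; apply: (@strip_le _ _ _ (r' + u)).
    by move: Ud; rewrite /r'; clear; lra.
  by apply: strip_add => //; apply: UM; exact: strip_le zr.
have rU z : strip r' z -> strip r (z + U z).
  by move=> /rU2; apply: strip_le; move: de0; clear; lra.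
have fcomp F : field r F -> field r' (fun z => F (z + U z)).
  by move=> fF; apply: field_comp fF (field_le r'r fU) rU.
have incr F M z : field r F -> bounded r F M -> strip r' z ->
    cnorm (F (z + U z) - F z) <= M / (delta / 2) * u.
  move=> fF FM zr.
  have M0 : 0 <= M := le_trans (cnorm_ge0 _) (FM _ (strip_real 0 r0)).
  have zr2 : strip (r - delta / 2) z.
    by apply: strip_le zr; rewrite /r'; move: de0; clear; lra.
  have half_room : r - delta / 2 + delta / 2 <= r by rewrite subrK.
  apply: le_trans (holo_lip (half_gt0 de0) (field_holo fF) FM half_room zr2
    (rU2 z zr)) _.
  apply: ler_wpM2l; last by apply: UM; exact: strip_le zr.
  by rewrite mulr_ge0// invr_ge0 ltW// half_gt0.
have jacUE z : strip r z -> jac U z = t%:C *: jac G z.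
  by move=> zr; apply/cderivE/cderivZ/(holo_cderiv (field_holo fG)).
have jacU z v : strip r' z -> cnorm (v *m jac U z) <= u / delta * cnorm v.
  by move=> zr; apply: (cauchy_strip de0 (field_holo fU) UM v r'd).
pose x' := t *: alpha - zvec x.
pose B z := (N (z + U z) - N z) + (S (z + U z) - S z) + W (z + U z) -
  cvec x' *m jac G z - (N z + A z) *m jac U z.
have fB : field r' B.
  apply: fieldB; [apply: fieldB; [apply: fieldD; [apply: fieldD|]|]|].
  - by apply: fieldB; [exact: fcomp|exact: field_le fN].
  - by apply: fieldB; [exact: fcomp|exact: field_le fS].
  - exact: fcomp.
  - apply: (field_mul_jac rd0 (field_cst _ x') (field_le r'r fG)).
    by move=> z zr; apply: GM; exact: strip_le zr.
  - apply: (field_mul_jac rd0 _ (field_le r'r fU)).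
      exact: field_le r'r (fieldD fN fA).
    by move=> z zr; apply: UM; exact: strip_le zr.
pose q := rho / (2 * d%:R); pose c := (64 * d%:R)^-1 : R.
have q0 : 0 <= q by rewrite divr_ge0// mulr_ge0// (le_trans ler01).
have d0 : 0 < d%:R :> R by exact: lt_le_trans d1.
have kE : (32 * d%:R)^-1 * rho = q / 16.
  by rewrite /q; field; rewrite gt_eqF.
have bk : b / delta <= (32 * d%:R)^-1.
  by rewrite ler_pdivrMr// ler_pdivlMl// mulr_gt0.
have bq : b * rho / delta <= q / 16.
  by rewrite mulrAC -kE ler_wpM2r.
have Eq : eps * u / delta <= q / 32.
  have h : eps * u <= b * rho / 2.
    rewrite /u mulrA (mulrC eps) [leRHS]mulrAC; exact: ler_wpM2r te.
  have := ler_wpM2r (ltW (_ : 0 < delta^-1)) h; rewrite invr_gt0 => /(_ de0).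
  by move: bq; set y := delta^-1; clear; lra.
have rhou : rho * u / delta <= eps * u / delta.
  by rewrite ler_wpM2r ?invr_ge0 ?(ltW de0)// ler_wpM2r.
(* In units of [q / 32], the four terms of [B] other than [W] contribute
   4, 2, 2 and 3. *)
have BM : bounded r' B (q * (j%:R + 11 / 32)).
  move=> z zr; have zr0 : strip r z by exact: strip_le zr.
  have hN : cnorm (N (z + U z) - N z) <= 4 * (q / 32).
    apply: le_trans (incr N _ z fN NM zr) _.
    rewrite (_ : 2 * eps / (delta / 2) * u = 4 * (eps * u / delta)).
      by rewrite ler_wpM2l.
    by field; rewrite gt_eqF.
  have hS : cnorm (S (z + U z) - S z) <= 2 * (q / 32).
    apply: le_trans (incr S _ z fS SM zr) _.
    rewrite (_ : rho / (delta / 2) * u = 2 * (rho * u / delta)).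
      by rewrite ler_wpM2l// (le_trans rhou).
    by field; rewrite gt_eqF.
  have hW : cnorm (W (z + U z)) <= q * j%:R.
    by rewrite (le_trans (WM _ (rU z zr)))// /q mulrAC -mulrA.
  have hx : cnorm (cvec x' *m jac G z) <= q / 16.
    apply: (le_trans (cauchy_strip de0 (field_holo fG) GM (cvec x') r'd zr)).
    rewrite cnorm_cvec; apply: le_trans bq; rewrite mulrAC ler_wpM2r//.
      by rewrite invr_ge0 ltW.
    by rewrite mulrC ler_wpM2r.
  have hNA : cnorm ((N z + A z) *m jac U z) <= 3 * (q / 32).
    apply: le_trans (jacU z (N z + A z) zr) _.
    have h : cnorm (N z + A z) <= 3 * eps.
      apply: le_trans (cnormD_le (NM z zr0) (AM z zr0)) _.
      by move: rhoe; clear; lra.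
    apply: le_trans (ler_wpM2l _ h) _; first by rewrite mulr_ge0// invr_ge0 ltW.
    rewrite (_ : u / delta * (3 * eps) = 3 * (eps * u / delta)).
      by rewrite ler_wpM2l.
    by field; rewrite gt_eqF.
  rewrite /B; apply: le_trans (cnormB_le (cnormB_le (cnormD_le (cnormD_le hN hS)
    hW) hx) hNA) _.
  by clear; lra.
have cu : u / delta <= c.
  have -> : c = (32 * d%:R)^-1 / 2 by rewrite /c; field; rewrite gt_eqF.
  apply: (@le_trans _ _ (b / delta / 2)); last by rewrite ler_wpM2r.
  by rewrite [leRHS]mulrAC ler_wpM2r// invr_ge0 ltW.
have c2 : c <= 2^-1.
  rewrite /c lef_pV2 ?posrE ?mulr_gt0//; move: d1; clear; lra.
have jacUc z v : strip r' z -> cnorm (v *m jac U z) <= c * cnorm v.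
  by move=> zr; rewrite (le_trans (jacU z v zr))// ler_wpM2r ?cnorm_ge0.
have [W' [fW' W'E W'M]] := field_solve rd0 (field_le r'r fU)
  (fun z zr => UM z (strip_le r'r zr)) fB BM c2 jacUc.
exists U, A, W'; split.
- split.
  + exact: field_le fU.
  + by move=> z zr; rewrite (le_trans _ uE)// UM//; exact: strip_le zr.
  + exact: rU.
  + exists 2^-1 => // z w zr wr.
    have -> : z + U z - (w + U w) = z - w - (U w - U z) by coordinates; ring.
    have := holo_lip de0 (field_holo fU) UM r'd zr (v := w - z).
    rewrite subrKC => /(_ wr) h.
    have := cnormB (z - w - (U w - U z)) (- (U w - U z)).
    rewrite opprK subrK cnormN (cnormC z) => k1.
    have := cnorm_ge0 (w - z).
    have : u / delta * cnorm (w - z) <= 2^-1 * cnorm (w - z).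
      by rewrite ler_wpM2r ?cnorm_ge0// (le_trans cu).
    move: h k1; clear; lra.
  + move=> z zr; have c1 : 0 < 1 - c by move: c2; clear; lra.
    apply: (expanding_unitmx c1); apply: near_identity_expanding => v.
    exact: jacUc.
  + move=> z zr; have zr0 : strip r z by exact: strip_le zr.
    have [_ xG _] := AGP z zr0.
    rewrite mulmxDl W'E// /B mulmxDr mulmx1.
    have e1 : cvec alpha *m jac U z = cvec x' *m jac G z + (S z - A z).
      rewrite -xG -mulmxDl jacUE// -scalemxAr scalemxAl -cvecZ; congr (_ *m _).
      by rewrite /czvec -cvecD subrK.
    rewrite -[cvec alpha + N z + A z]addrA mulmxDl e1.
    by coordinates; ring.
- by split=> //; exact: field_le fA.
- by move=> z zr; apply: AM; exact: strip_le zr.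
- move=> z zr; apply: le_trans (W'M z zr) _.
  rewrite ler_pdivrMr; last by move: c2; clear; lra.
  have -> : rho * (j.+1%:R / (2 * d%:R)) = q * (j%:R + 1).
    by rewrite /q -natr1; field; rewrite gt_eqF.
  rewrite -[leRHS]mulrA ler_wpM2l//.
  have : (j%:R + 1) * c <= 64^-1.
    by rewrite /c invfM mulrCA ler_piMr// natr1 ler_pdivrMr// mul1r ler_nat.
  by move: (j%:R) => y; clear; lra.
- move=> z zr; have [xA _ vA] := AGP z (strip_le r'r zr).
  by split=> // v; exact: vA.
Qed.

End Conjugation.

(** * Successive averagings *)

Section Iteration.
Context {R : realType} {n : nat}.
Implicit Types (z w v : 'rV[R[i]]_n) (U V W N S P Q : 'rV[R[i]]_n -> 'rV[R[i]]_n).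
Variables (alpha : 'rV[R]_n) (delta b eps : R) (d : nat).
Hypotheses (delta0 : 0 < delta) (eps0 : 0 < eps) (dbd : 32 * d%:R * b <= delta).

(** A pair [(x, t)] stands for the periodic approximation [t^-1 *: zvec x] of
    [alpha].  Multiplying by [t] makes both conditions meaningful for [t = 0]. *)
Definition approximates (p : 'rV[int]_n * R) : Prop :=
  `|p.2| * eps <= b / 2 /\ `|p.2 *: alpha - zvec p.1| <= b.

(** A later averaging preserves the invariances produced by the earlier ones, so
    that the final mean is invariant along the whole list. *)
Lemma averaging_steps (l : seq ('rV[int]_n * R)) (r rho : R) (j : nat) N S W :
  (forall p, p \in l -> approximates p) ->
  0 < r - (size l)%:R * delta -> 0 <= rho <= eps -> (j + size l <= d)%N ->
  field r N -> field r S -> field r W ->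
  bounded r N (2 * eps) -> bounded r S rho ->
  bounded r W (rho * (j%:R / (2 * d%:R))) ->
  let r' := r - (size l)%:R * delta in
  exists U S' W', [/\
    conjugates r r' ((size l)%:R * (b / 2 * (rho / eps)))
      (fun z => cvec alpha + N z + S z + W z)
      (fun z => cvec alpha + N z + S' z + W' z) U,
    field r' S' /\ field r' W',
    bounded r' S' rho,
    bounded r' W' (rho * ((j + size l)%:R / (2 * d%:R))) &
    forall z, strip r' z -> (forall p, p \in l -> czvec p.1 *m jac S' z = 0) /\
      forall v, (forall w, strip r w -> v *m jac S w = 0) -> v *m jac S' z = 0].
Proof.
move=> + + rho01; elim: l r j S W => [|[x t] l IH] r j S W la.
  rewrite /= mul0r subr0 addn0 => r0 _ fN fS fW NM SM WM.
  exists (fun=> 0), S, W; split=> //.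
  - by rewrite mul0r; exact: conjugates_id.
  - by move=> z zr; split=> // v; exact.
set r' := r - (size ((x, t) :: l))%:R * delta => r'0 jl fN fS fW NM SM WM; cbv zeta.
have r'E : r' = r - delta - (size l)%:R * delta.
  by rewrite /r' /= -natr1 mulrDl mul1r opprD addrA addrAC.
have ld0 : 0 <= (size l)%:R * delta by rewrite mulr_ge0// ltW.
have [te talpha] := la (x, t) (mem_head _ _).
have rd0 : 0 < r - delta.
  by rewrite r'E in r'0; apply: lt_le_trans r'0 _; rewrite gerDl oppr_le0.
have jd : (j < d)%N.
  by move: jl; rewrite /= addnS; apply: leq_ltn_trans; rewrite leq_addr.
have [U1 [S1 [W1 [C1 [fS1 fW1] S1M W1M inv1]]]] :=
  averaging_step delta0 rd0 eps0 rho01 jd te talpha dbd fN fS fW NM SM WM.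
have rdr : r - delta <= r by rewrite gerDl oppr_le0 ltW.
have la' p : p \in l -> approximates p.
  by move=> pl; apply: la; rewrite in_cons pl orbT.
have r'0' : 0 < r - delta - (size l)%:R * delta by rewrite -r'E.
have jl' : (j.+1 + size l <= d)%N by rewrite addSnnS.
have [|U2 [S2 [W2 [C2 [fS2 fW2] S2M W2M inv2]]]] :=
  IH (r - delta) j.+1 S1 W1 la' r'0' jl' (field_le rdr fN) fS1 fW1 _ S1M W1M.
  by move=> z zr; apply: NM; exact: strip_le zr.
rewrite -r'E in C2 fS2 fW2 S2M W2M inv2.
have r'r : r' <= r - delta by rewrite r'E gerDl oppr_le0.
exists (fun z => U1 (z + U2 z) + U2 z), S2, W2; split.
- apply: conjugates_eq (conjugates_trans C1 C2) => [|z|z]; [|by []|by []].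
  by rewrite /= -[(size l).+1%:R]natr1 mulrDl mul1r addrC.
- by split.
- exact: S2M.
- by rewrite /= addnS -addSn.
- move=> z zr; have [inv2l inv2v] := inv2 z zr; split.
    move=> p; rewrite in_cons => /orP[/eqP ->|]; last exact: inv2l.
    by apply: inv2v => w wr; have [] := inv1 w wr.
  by move=> v vS; apply: inv2v => w wr; have [_] := inv1 w wr; apply.
Qed.

(** Each round of [d] averagings halves the remainder; the geometric series of
    the remainders bounds the normal form and the displacement. *)
Lemma averaging_iteration (l : seq ('rV[int]_n * R)) (s : R) (m k : nat) P :
  (forall p, p \in l -> approximates p) -> size l = d -> (0 < d)%N ->
  0 < s - m%:R * (d%:R * delta) -> field s P -> bounded s P eps -> (k <= m)%N ->
  let r := s - k%:R * (d%:R * delta) in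
  exists U N Q, [/\
    conjugates s r (d%:R * b * (1 - 2 ^- k))
      (fun z => cvec alpha + P z) (fun z => cvec alpha + N z + Q z) U,
    field r N /\ field r Q,
    bounded r N (2 * eps * (1 - 2 ^- k)),
    bounded r Q (eps * 2 ^- k) &
    forall z, strip r z -> forall p, p \in l -> czvec p.1 *m jac N z = 0].
Proof.
move=> la ld d0 sm fP PM; have dd0 : 0 <= d%:R * delta by rewrite mulr_ge0// ltW.
elim: k => [|k IH] km.
  rewrite /= mul0r subr0 expr0 invr1 subrr mulr1 !mulr0.
  exists (fun=> 0), (fun=> 0), P.
  split.
  - apply: conjugates_eq (conjugates_id _ _) => [|z|z]; [by []|by []|].
    by rewrite addr0.
  - by split=> //; exact: field0.
  - by move=> z _; rewrite cnorm0.
  - exact: PM.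
  - by move=> z _ p _; rewrite (cderivE (cderiv_cst _ _)) mulmx0.
have [U1 [N [Q [C1 [fN fQ] NM QM inv]]]] := IH (ltnW km); cbv zeta.
set r := s - k%:R * (d%:R * delta) in C1 fN fQ NM QM inv *.
set r' := s - k.+1%:R * (d%:R * delta).
have r'E : r' = r - (size l)%:R * delta.
  by rewrite /r' /r ld -natr1 mulrDl mul1r opprD addrA.
have r'0 : 0 < r'.
  apply: lt_le_trans sm _; rewrite lerD2l lerN2 ler_wpM2r// ler_nat//.
have r'r : r' <= r by rewrite r'E gerDl oppr_le0 mulr_ge0// ltW.
have r0 : 0 < r by exact: lt_le_trans r'r.
have k0 : 0 < 2 ^- k :> R := exp2V_gt0 k.
have k1 : 2 ^- k <= 1 :> R by rewrite invf_le1 ?exprn_gt0 ?exprn_ege1 ?ler1n.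
have rho01 : 0 <= eps * 2 ^- k <= eps.
  by rewrite mulr_ge0 ?(ltW eps0) ?(ltW k0)//= ler_piMr// ltW.
have r'0' : 0 < r - (size l)%:R * delta by rewrite -r'E.
have jd : (0 + size l <= d)%N by rewrite ld.
have NM' : bounded r N (2 * eps).
  move=> z zr; apply: le_trans (NM z zr) _.
  by rewrite ler_piMr ?mulr_ge0 ?(ltW eps0)// gerDl oppr_le0 ltW.
have b0 : bounded r (fun _ : 'rV[R[i]]_n => 0) (eps * 2 ^- k * (0%:R / (2 * d%:R))).
  by move=> z _; rewrite cnorm0 mul0r mulr0.
have [U2 [S [W [C2 [fS fW] SM WM inv2]]]] :=
  averaging_steps la r'0' rho01 jd fN fQ (field0 r) NM' QM b0.
rewrite -r'E in C2 fS fW SM WM inv2.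
exists (fun z => U1 (z + U2 z) + U2 z), (fun z => N z + S z), W; split.
- have e : d%:R * b * (1 - 2 ^- k) + (size l)%:R * (b / 2 * (eps * 2 ^- k / eps)) <=
      d%:R * b * (1 - 2 ^- k.+1).
    rewrite ld [eps * _ / eps]mulrAC divff ?gt_eqF// mul1r exprS invfM.
    by move: (2 ^- k) => y; rewrite le_eqVlt; apply/orP; left; apply/eqP; field.
  apply: conjugates_eq e _ _ (conjugates_trans C1 _) => [z|z|]; [by []| |].
    by rewrite addrA.
  apply: conjugates_eq (lexx _) _ _ C2 => z; [|by []].
  by rewrite addr0.
- by split; [apply: (fieldD (field_le r'r fN) fS)|exact: fW].
- move=> z zr; apply: le_trans (cnormD_le (NM z (strip_le r'r zr)) (SM z zr)) _.
  rewrite exprS invfM; move: (2 ^- k) => y.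
  by rewrite le_eqVlt; apply/orP; left; apply/eqP; field.
- move=> z zr; apply: le_trans (WM z zr) _.
  rewrite add0n ld exprS [(2 * 2 ^+ k)^-1]invfM; move: (2 ^- k) => y.
  rewrite le_eqVlt; apply/orP; left; apply/eqP; field.
  by rewrite pnatr_eq0 -lt0n.
- move=> z zr p pl; have [inv2l _] := inv2 z zr.
  rewrite (cderivE (cderivD (holo_cderiv (field_holo fN) (strip_le r'r zr))
    (holo_cderiv (field_holo fS) zr))) mulmxDr inv2l// addr0.
  exact: inv (strip_le r'r zr) _ pl.
Qed.

End Iteration.

(** * Rational approximations of the frequency vector *)

Section Approximations.
Context {R : realType} {n : nat}.
Implicit Types (alpha : 'rV[R]_n) (K Q : R).

Lemma norm_zvec_int (x : 'rV[int]_n) K :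
  `|zvec x : 'rV[R]_n| < (Num.floor K + 1)%:~R -> `|zvec x : 'rV[R]_n| <= K.
Proof.
move=> xK; have fl0 : 0 <= Num.floor K.
  by rewrite -ltzD1 -(ltr_int R); exact: le_lt_trans xK.
apply/rnormP; split=> [|j].
  by rewrite (le_trans _ (floor_le K))// ler0z.
rewrite (le_trans _ (floor_le K))// mxE -intr_norm ler_int -ltzD1 -(ltr_int R).
apply: le_lt_trans xK; rewrite intr_norm.
by have := rnorm_entry (zvec x : 'rV[R]_n) j; rewrite mxE.
Qed.

(** The infimum in the definition of [Psi] is attained because the norms of
    integer vectors are integers. *)
Lemma Psi_vectors (i0 : 'I_n) alpha Q K :
  (Psi i0 alpha Q <= K%:E)%E ->
  exists x : (num_eff_freq alpha).-tuple 'rV[int]_n,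
    free (map (@zvec R n) x) /\ forall v, v \in x ->
      [/\ zvec v \in rational_hull alpha, `|zvec v : 'rV[R]_n| <= K &
          `|zvec v 0 i0 *: alpha - alpha 0 i0 *: zvec v| <= Q^-1].
Proof.
move=> PK; have : (Psi i0 alpha Q < ((Num.floor K + 1)%:~R)%:E)%E.
  by rewrite (le_lt_trans PK)// lte_fin; exact: floorD1_gt.
move=> /ereal_inf_lt[_ [k [k0 [x [fx xP]]] <-]]; rewrite lte_fin => kK.
exists x; split=> // v /xP[vh vk va]; split=> //.
by apply: norm_zvec_int; exact: le_lt_trans kK.
Qed.

Lemma alpha_in_span alpha (x : (num_eff_freq alpha).-tuple 'rV[int]_n) :
  free (map (@zvec R n) x) ->
  (forall v, v \in x -> zvec v \in rational_hull alpha) ->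
  alpha \in <<map (@zvec R n) x>>%VS.
Proof.
move=> fx xh; have : basis_of (rational_hull alpha) (map (@zvec R n) x).
  rewrite basisEfree fx size_map size_tuple leqnn andbT /=.
  by apply/span_subvP => _ /mapP[v vx ->]; exact: xh.
by move=> /span_basis ->; have [] := rational_hullP alpha.
Qed.

Lemma num_eff_freq_gt0 alpha : alpha != 0 -> (0 < num_eff_freq alpha)%N.
Proof.
move=> a0; have [_ aV _] := rational_hullP alpha.
rewrite lt0n dimv_eq0; apply: contraNneq a0 => V0.
by move: aV; rewrite V0 memv0.
Qed.

Lemma span_mulmx0 m (X : seq 'rV[R]_n) alpha (A : 'M[R[i]]_(n, m)) :
  (forall x, x \in X -> cvec x *m A = 0) -> alpha \in <<X>>%VS ->
  cvec alpha *m A = 0.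
Proof.
move=> XA /(@coord_span _ _ _ (in_tuple X)) ->.
apply: (big_ind (fun y => cvec y *m A = 0)) => [|x y xA yA|i _].
- have -> : cvec (0 : 'rV[R]_n) = 0 by apply/rowP => j; rewrite !mxE.
  by rewrite mul0mx.
- by rewrite cvecD mulmxDl xA yA addr0.
- by rewrite cvecZ -scalemxAl XA ?scaler0// mem_nth.
Qed.

End Approximations.

Section Powers.
Context {R : realType}.
Implicit Types (h p y : R).

(** The form in which smallness of [h] is used: as a lower bound on
    [h `^ (- (1 / p))]. *)
Lemma powR_root_le h p y : 0 < h -> 0 < p -> 0 < y -> h <= y `^ (- p) ->
  y <= h `^ (- (1 / p)).
Proof.
move=> h0 p0 y0 hy.
have := @ge0_ler_powR R (1 / p) (ltW (divr_gt0 ltr01 p0)) h (y `^ (- p)).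
rewrite !nnegrE (ltW h0) powR_ge0 => /(_ isT isT hy).
rewrite -powRrM mulNr mul1r divff ?gt_eqF// => hy1.
rewrite powRN -[leLHS]invrK lef_pV2 ?posrE ?invr_gt0 ?powR_gt0//.
by rewrite -(powR_inv1 (ltW y0)).
Qed.

End Powers.

(** * Embeddings and pullbacks *)

Section Embedding.
Context {R : realType} {n : nat}.
Implicit Types (z w v : 'rV[R[i]]_n) (U V F : 'rV[R[i]]_n -> 'rV[R[i]]_n).
Implicit Types (r s e M : R).

Lemma supnorm_le r F M : bounded r F M -> (supnorm r F <= M%:E)%E.
Proof.
by move=> FM; apply: ge_ereal_sup => _ [z zr <-]; rewrite lee_fin FM.
Qed.

Lemma supnorm_bounded r F M : (supnorm r F <= M%:E)%E -> bounded r F M.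
Proof.
move=> FM z zr; rewrite -lee_fin; apply: le_trans FM.
by apply: ereal_sup_ubound; exists z.
Qed.

Lemma displacement_embedding s r e V V' U : conjugates s r e V V' U ->
  real_analytic_embedding r s (fun z => z + U z).
Proof.
move=> [fU Ue rU [c c0 Uc] Uu _].
have per z k : strip r z -> z + czvec k + U (z + czvec k) = z + U z + czvec k.
  by move=> zr; rewrite (field_periodic k fU zr) addrAC.
split.
- by move=> z k; exact: per.
- exact: rU.
- split.
    move=> z zr; exact: (cderiv_differentiable
      (cderiv_displacement (holo_cderiv (field_holo fU) zr))).1.
  by move=> x; rewrite imvecD imvec_cvec (field_real x fU) addr0.
- move=> z w zr wr [k zwk]; exists k; apply/eqP; rewrite -subr_eq0 -cnorm_eq0.
  have wkr : strip r (w + czvec k) by rewrite strip_translate.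
  have := Uc _ _ zr wkr; rewrite per// zwk subrr cnorm0 pmulr_rle0// => zw.
  by rewrite eq_le zw cnorm_ge0.
- move=> z zr; rewrite (_ : 'J _ z = 1%:M + jac U z) ?Uu//.
  rewrite -(cderivE (cderiv_displacement (holo_cderiv (field_holo fU) zr))).
  by rewrite jac.unlock.
- move=> z zr d d0; exists (c * d) => [|w wr [k wzk]]; first exact: mulr_gt0.
  exists k; have zkr : strip r (z + czvec k) by rewrite strip_translate.
  rewrite -(ltr_pM2l c0); apply: le_lt_trans wzk.
  have := Uc _ _ wr zkr; rewrite per//.
  by rewrite !opprD !addrA.
Qed.

Lemma conjugates_pullback s r e V V' U z : conjugates s r e V V' U ->
  strip r z -> pullback (fun z => z + U z) V z = V' z.
Proof.
move=> [fU _ _ _ Uu UV] zr; rewrite /pullback (_ : 'J _ z = 1%:M + jac U z).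
  by rewrite -UV// mulmxK// Uu.
rewrite -(cderivE (cderiv_displacement (holo_cderiv (field_holo fU) zr))).
by rewrite jac.unlock.
Qed.

Lemma diff_jac F z v : 'd F z v = v *m jac F z.
Proof. by rewrite jac.unlock /jacobian mul_rV_lin1. Qed.

Lemma lie_bracket_constant alpha F z :
  lie_bracket (constant_field alpha) F z = cvec alpha *m jac F z.
Proof.
have dF := diff_jac F z (cvec alpha).
have dc : 'd (constant_field alpha) z (F z) = 0.
  by rewrite diff_jac (cderivE (cderiv_cst (cvec alpha) z)) mulmx0.
by apply: etrans (congr2 (fun a b => a - b) dF dc) _; rewrite subr0.
Qed.

End Embedding.

(** * The normal form *)

Section Constants.
Context {R : realType} {n : nat}.
Implicit Types (alpha : 'rV[R]_n) (K Q : R).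

Lemma kappa_ge alpha : alpha != 0 ->
  64 * (num_eff_freq alpha)%:R ^+ 2 * `|alpha|^-1 <= kappa alpha.
Proof.
move=> a0; have d0 := num_eff_freq_gt0 a0; rewrite /kappa.
rewrite (_ : 2 ^+ 6 = 64); last by rewrite -natrX.
rewrite ler_wpM2r ?invr_ge0// ler_peMr ?mulr_ge0 ?exprn_ge0//.
rewrite lerBrDr (_ : 1 + 1 = 2 ^+ 1)// ler_eXn2l// ltr1n//.
Qed.

(** Here [t = v_0 / alpha_0].  As one never divides by [t], the case [v_0 = 0]
    is no exception. *)
Lemma Psi_approximates (i0 : 'I_n) alpha Q K (eps : R) (v : 'rV[int]_n) :
  0 < `|alpha| -> `|alpha| = `|alpha 0 i0| -> 0 < eps -> K * eps <= Q^-1 / 2 ->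
  `|zvec v : 'rV[R]_n| <= K ->
  `|zvec v 0 i0 *: alpha - alpha 0 i0 *: zvec v| <= Q^-1 ->
  approximates alpha (`|alpha|^-1 * Q^-1) eps (v, zvec v 0 i0 / alpha 0 i0).
Proof.
move=> a0 amax eps0 Keps vK va.
have ai0 : alpha 0 i0 != 0 by rewrite -normr_gt0 -amax.
split=> /=.
  rewrite normrM normfV -amax [_ / _]mulrC -!mulrA ler_pM2l ?invr_gt0//.
  apply: le_trans Keps; rewrite ler_pM2r//; apply: le_trans vK.
  exact: rnorm_entry.
rewrite (_ : _ - _ = (alpha 0 i0)^-1 *:
    (zvec v 0 i0 *: alpha - alpha 0 i0 *: zvec v)).
  by rewrite normrZ normfV -amax ler_pM2l ?invr_gt0.
by rewrite scalerBr !scalerA mulVf// scale1r mulrC.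
Qed.

End Constants.

Local Close Scope complex_scope.
Unset Implicit Arguments.
Set Strict Implicit.
Set Printing Implicit Defensive.

Theorem corollary3p2 (R : realType) (n : nat) (hn : (1 < n)%N)
    (alpha : 'rV[R]_n) (tau Qa Ca s eps : R)
    (P : 'rV[R[i]]_n -> 'rV[R[i]]_n) :
  let i0 : 'I_n := Ordinal (ltnW hn) in
  let d := num_eff_freq alpha in
  let X := constant_field alpha \+ P in
  alpha != 0 ->
  `|alpha| = `|alpha 0 i0| ->
  d%:R - 1 <= tau ->
  Diophantine alpha tau ->
  1 <= Qa -> 0 < Ca ->
  (forall Q : R, Qa <= Q -> (Psi i0 alpha Q <= (Ca * Q `^ tau)%:E)%E) ->
  0 < s -> 0 < eps ->
  real_analytic_vector_field s P ->
  (supnorm s P < +oo)%E ->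
  (supnorm s P <= eps%:E)%E ->
  eps < (2 * Ca)^-1 * E_alpha alpha Qa `^ (- (tau + 1)) ->
  eps <= (2 * Ca)^-1 * (kappa alpha * s^-1) `^ (- (tau + 1)) ->
  exists Phi N Rem : 'rV[R[i]]_n -> 'rV[R[i]]_n,
    [/\ real_analytic_embedding (s / 2) s Phi,
        real_analytic_vector_field (s / 2) N,
        real_analytic_vector_field (s / 2) Rem,
        forall z, strip (s / 2) z ->
          pullback Phi X z = constant_field alpha z + N z + Rem z &
        forall z, strip (s / 2) z ->
          lie_bracket (constant_field alpha) N z = 0] /\
    [/\ (supnorm (s / 2) (fun z => (Phi z - z)%R) <
          (d%:R ^+ 2 * `|alpha|^-1 * (2 * Ca * eps) `^ (1 / (1 + tau)))%:E)%E,
        (supnorm (s / 2) N < (2 * eps)%:E)%E &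
        (supnorm (s / 2) Rem <
          (2 * eps * expR (- (ln 2 * (kappa alpha)^-1 * s *
                              (2 * Ca * eps) `^ (- (1 / (1 + tau))))))%:E)%E].
Proof.
move=> i0 d X a0 amax dtau _ Qa1 Ca0 PsiQ s0 eps0 fP _ /supnorm_bounded PM.
move=> epsE epsk.
have d0 : (0 < d)%N := num_eff_freq_gt0 a0.
have na : 0 < `|alpha| by rewrite normr_gt0.
have d1 : 1 <= d%:R :> R by rewrite ler1n.
set p := 1 + tau; set h := 2 * Ca * eps.
have p0 : 0 < p by rewrite /p; move: dtau d1; lra.
have h0 : 0 < h by rewrite !mulr_gt0.
(* With this [Q] one has [h = Q `^ (- p)], which balances the periods, at most
   [Ca * Q `^ tau / `|alpha|], against [eps]. *)
set Q := h `^ (- (1 / p)).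
have Q0 : 0 < Q by exact: powR_gt0.
have large y : 0 < y -> eps <= (2 * Ca)^-1 * y `^ (- (tau + 1)) -> y <= Q.
  move=> y0; rewrite ler_pdivlMl ?mulr_gt0// (addrC tau).
  exact: powR_root_le.
have E0 : 0 < E_alpha alpha Qa by rewrite lt_max ltr01.
have QaQ : Qa <= Q.
  by apply: le_trans (large _ E0 (ltW epsE)); rewrite !le_max lexx !orbT.
have k_ge := kappa_ge a0.
have k0 : 0 < kappa alpha.
  by apply: lt_le_trans k_ge; rewrite !mulr_gt0 ?invr_gt0 ?exprn_gt0 ?ltr0n.
have kQ : kappa alpha * s^-1 <= Q.
  by apply: large epsk; rewrite mulr_gt0 ?invr_gt0.
have hQ : h `^ (1 / p) = Q^-1 by rewrite /Q powRN invrK.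
have Qp : Q `^ (- p) = h.
  by rewrite /Q -powRrM mulrNN mul1r mulVf ?gt_eqF// powRr1 ?ltW.
have [x [fx xP]] := Psi_vectors (PsiQ Q QaQ).
have Keps : Ca * Q `^ tau * eps <= Q^-1 / 2.
  have -> : Q^-1 = Q `^ tau * h.
    rewrite -Qp -powRD; last by apply/implyP => _; rewrite gt_eqF.
    by rewrite /p opprD addrCA subrr addr0 powR_inv1 ?ltW.
  by rewrite /h; lra.
pose l := [seq (v, zvec v 0 i0 / alpha 0 i0 : R) | v <- x].
set b := `|alpha|^-1 * Q^-1.
have la q : q \in l -> approximates alpha b eps q.
  move=> /mapP[v /xP[_ vK va] ->].
  exact: Psi_approximates Keps vK va.
have ld : size l = d by rewrite size_map size_tuple.
pose y := s * Q / kappa alpha.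
have y1 : 1 <= y.
  by rewrite /y ler_pdivlMr// mul1r mulrC -ler_pdivrMr.
(* The number of rounds of averaging; a step narrows the strip by [delta]. *)
pose m := Num.truncn y.
have /andP[my ym] : m%:R <= y < m.+1%:R by rewrite truncn_itv// (le_trans ler01).
have m0 : (0 < m)%N.
  by rewrite -ltnS -(ltr_nat R); exact: le_lt_trans ym.
have md0 : 0 < 2 * m%:R * d%:R :> R by rewrite !mulr_gt0 ?ltr0n.
pose delta := s / (2 * m%:R * d%:R).
have delta0 : 0 < delta by rewrite divr_gt0.
have dbd : 32 * d%:R * b <= delta.
  rewrite ler_pdivlMr// /b.
  have h1 : m%:R * (64 * d%:R ^+ 2 * `|alpha|^-1) <= s * Q.
    apply: le_trans (_ : m%:R * kappa alpha <= _); first by rewrite ler_wpM2l.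
    by rewrite -ler_pdivlMr.
  rewrite [leLHS](_ : _ = m%:R * (64 * d%:R ^+ 2 * `|alpha|^-1) / Q).
    by rewrite ler_pdivrMr.
  by move: (Q^-1) (`|alpha|^-1) => u w; ring.
have sE : s - m%:R * (d%:R * delta) = s / 2.
  by rewrite /delta; field; rewrite !pnatr_eq0 -!lt0n m0 d0.
have sm : 0 < s - m%:R * (d%:R * delta) by rewrite sE half_gt0.
have [U [N [Rem [CU [fN fRem] NM RemM Ninv]]]] :=
  averaging_iteration delta0 eps0 dbd la ld d0 sm fP PM (leqnn m).
rewrite sE in CU fN fRem NM RemM Ninv.
have b0 : 0 < b by rewrite mulr_gt0 ?invr_gt0.
have m1 : 1 - 2 ^- m < 1 :> R by rewrite gtrDl oppr_lt0 exp2V_gt0.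
exists (fun z => z + U z), N, Rem; split; split.
- exact: displacement_embedding CU.
- exact: fN.
- exact: fRem.
- by move=> z zs; exact: conjugates_pullback CU zs.
- move=> z zs; rewrite lie_bracket_constant.
  apply: (span_mulmx0 _ (alpha_in_span fx _)) => [w /mapP[v vx ->]|v /xP[]//].
  by apply: (Ninv z zs (v, zvec v 0 i0 / alpha 0 i0)); exact: map_f.
- apply: (@le_lt_trans _ _ (d%:R * b * (1 - 2 ^- m))%:E).
    apply: supnorm_le => z zs; rewrite addrC addKr; exact: conj_close CU _ zs.
  rewrite lte_fin hQ -[ltRHS]mulrA -/b; apply: (@lt_le_trans _ _ (d%:R * b)).
    by rewrite gtr_pMr// mulr_gt0// ltr0n.
  by rewrite ler_wpM2r ?(ltW b0)// expr2 ler_peMr.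
- apply: le_lt_trans (supnorm_le NM) _; rewrite lte_fin.
  by rewrite gtr_pMr// mulr_gt0.
- apply: le_lt_trans (supnorm_le RemM) _; rewrite lte_fin.
  rewrite [2 * eps]mulrC -[ltRHS]mulrA ltr_pM2l//.
  have -> : ln 2 * (kappa alpha)^-1 * s * Q = ln 2 * y.
    by rewrite /y; move: (kappa alpha)^-1 => u; ring.
  (* Rounding [y] down to [m] costs less than a factor 2. *)
  have -> : 2 ^- m = 2 * expR (- (ln 2 * m.+1%:R)) :> R.
    rewrite expRN mulrC -[ln 2 * _]mulrC mulrC expRM_natl lnK ?posrE//.
    by rewrite exprS invfM mulrA divff// mul1r.
  rewrite ltr_pM2l// ltr_expR ltrN2 ltr_pM2l// ln_gt0// ltr1n//.
Qed.
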